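(* Let $H$ be a finite simple connected graph with $|V(H)|\ge2$ and $H\ne K_2$. Let $\{G_n\}_{n\ge1}$ be a sequence of finite simple graphs with $|V(G_n)|\to\infty$, whose vertices are colored uniformly at random with $c_n$ colors, where $c_n\to\infty$. Suppose that: - for every integer $k\in[1,N(H,K_{|V(H)|})]$ there exists $\lambda_k\ge0$ such that $$\lim_{n\to\infty}\frac{\sum_{F\in\mathscr{C}_{H,k}}N_{\mathrm{ind}}(F,G_n)}{c_n^{|V(H)|-1}}=\lambda_k;$$ - for every integer $t\in[2,|V(H)|-1]$ and every $F\in\mathscr{J}_t(H)$, $N(F,G_n)=o\big(c_n^{2|V(H)|-t-1}\big)$ as $n\to\infty$. Then $T(H,G_n)$ converges in distribution to $$\sum_{k=1}^{N(H,K_{|V(H)|})}k\,Z_k,$$ where $Z_k\sim\mathrm{Pois}(\lambda_k)$ and the collection $\{Z_k:1\le k\le N(H,K_{|V(H)|})\}$ is independent.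
   Context: In a uniformly random $c_n$-coloring the vertices $v\in V(G_n)$ receive independent colors $X_v$, uniform on $\{1,\dots,c_n\}$. With $V(H)=\{1,\dots,|V(H)|\}$ and $(a_{ij}(G_n))$ the adjacency matrix of $G_n$, $$T(H,G_n)=\frac{1}{|Aut(H)|}\sum_{\boldsymbol s}\prod_{(a,b)\in E(H)}a_{s_as_b}(G_n)\,\mathbf 1\{X_{s_1}=\cdots=X_{s_{|V(H)|}}\},$$ the sum over all $|V(H)|$-tuples of distinct vertices of $G_n$ (the number of monochromatic copies of $H$). $N(F,G)$ is the number of copies of $F$ in $G$ (subgraphs of $G$ isomorphic to $F$); $N_{\mathrm{ind}}(F,G)$ is the number of induced copies (induced subgraphs of $G$ isomorphic to $F$). $K_m$ is the complete graph on $m$ vertices. $\mathscr{C}_{H,k}$ is the collection of non-isomorphic (unlabelled) graphs $F$ with $|V(F)|=|V(H)|$, containing $H$ as a subgraph, with $N(H,F)=k$. $t$-join: let $H'$ be an isomorphic copy of $H$ with $V(H')=\{1',\dots,|V(H)|'\}$ disjoint from $V(H)$, $z'$ being the image of $z$. For ordered tuples $J_1=(j_{11},\dots,j_{1t})$, $J_2=(j_{21},\dots,j_{2t})$ of $t$ distinct elements of $\{1,\dots,|V(H)|\}$, $H_t(J_1,J_2)$ is the simple graph obtained as the union of $H$ and $H'$ after identifying the vertex $j_{1a}\in V(H)$ with $j_{2a}'\in V(H')$ for each $a=1,\dots,t$ (repeated edges merged). $\mathscr{J}_t(H)$ is the collection, up to isomorphism, of all graphs $H_t(J_1,J_2)$.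 $\mathrm{Pois}(0)$ is the point mass at $0$. *)

(* Defs.v *)
From HB Require Import structures.
From mathcomp Require Import all_boot all_order all_algebra finmap perm.
From mathcomp Require Import all_classical all_reals all_analysis.
From mathcomp Require Import measurable_realfun.

Set Implicit Arguments.
Unset Strict Implicit.
Unset Printing Implicit Defensive.

Import Order.TTheory GRing.Theory Num.Theory.
Import numFieldNormedType.Exports.

Local Open Scope classical_set_scope.
Local Open Scope ring_scope.

(** * Finite simple graphs *)

(** A simple graph on the vertex type [V], given by its set of edges, each of
    them an unordered pair of distinct vertices. *)
Record sgraph (V : finType) := SGraph {
  edges : {set {set V}};
  edgesP : [forall e in edges, #|e| == 2%N]
}.

HB.instance Definition _ (V : finType) := [isSub for @edges V].
HB.instance Definition _ (V : finType) := [Finite of sgraph V by <:].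

Definition adj (V : finType) (G : sgraph V) (u v : V) : bool :=
  [set u; v]%SET \in edges G.

Lemma sgraph_of_subproof (V : finType) (E : {set {set V}}) :
  [forall e in [set e in E | #|e| == 2%N]%SET, #|e| == 2%N].
Proof. by apply/forall_inP => e; rewrite inE => /andP[]. Qed.

(** Members of [E] that are not pairs are discarded. *)
Definition sgraph_of (V : finType) (E : {set {set V}}) : sgraph V :=
  SGraph (sgraph_of_subproof E).

Definition complete (m : nat) : sgraph 'I_m := sgraph_of [set: {set 'I_m}]%SET.

Definition connected_graph (V : finType) (G : sgraph V) : Prop :=
  forall u v : V, connect (adj G) u v.

Definition image_edges (U V : finType) (f : U -> V) (E : {set {set U}}) :
    {set {set V}} :=
  [set [set f x | x in e]%SET | e : {set U} in E]%SET.

(** The graph with vertex set [S] and edge set [E] is isomorphic to [F]. *)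
Definition is_copy (U V : finType) (F : sgraph U)
    (S : {set V}) (E : {set {set V}}) : bool :=
  [exists f : {ffun U -> V},
    [&& injectiveb f, S == [set f x | x : U]%SET
      & E == image_edges f (edges F)]].

Definition iso (U V : finType) (F : sgraph U) (G : sgraph V) : bool :=
  is_copy F [set: V]%SET (edges G).

(** Subgraphs of [G] are pairs (vertex set, edge set). *)
Definition subgraph (V : finType) (G : sgraph V)
    (p : {set V} * {set {set V}}) : bool :=
  (p.2 \subset edges G) && [forall e in p.2, e \subset p.1].

(** [N(F, G)] *)
Definition ncopies (U V : finType) (F : sgraph U) (G : sgraph V) : nat :=
  #|[set p : {set V} * {set {set V}} |
      subgraph G p && is_copy F p.1 p.2]%SET|.

Definition induced_edges (V : finType) (G : sgraph V) (S : {set V}) :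
    {set {set V}} :=
  [set e in edges G | e \subset S]%SET.

(** [N_ind(F, G)] *)
Definition ninduced (U V : finType) (F : sgraph U) (G : sgraph V) : nat :=
  #|[set S : {set V} | is_copy F S (induced_edges G S)]%SET|.

Definition Aut (V : finType) (H : sgraph V) : {set {perm V}} :=
  [set p : {perm V} | [forall u, forall v, adj H (p u) (p v) == adj H u v]]%SET.

(** One representative of each isomorphism class of graphs in [D]. *)
Definition up_to_iso (V : finType) (D : {set sgraph V}) : {set sgraph V} :=
  transversal (equivalence_partition (@iso V V) D) D.

(** The collection [C_{H,k}] *)
Definition overgraphs (h : nat) (H : sgraph 'I_h) (k : nat) :
    {set sgraph 'I_h} :=
  up_to_iso [set F : sgraph 'I_h | (0 < ncopies H F)%N && (ncopies H F == k)]%SET.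

(** * Joins *)

(** The vertices of [H_t(J1, J2)]: those of [H], and the vertices of the copy
    [H'] that are not identified with a vertex of [H]. *)
Definition join_vertex (V : finType) (J2 : seq V) : finType :=
  (V + {z : V | z \notin J2})%type.

(** Where the vertex [z'] of [H'] goes: the [a]-th entry of [J2] becomes the
    [a]-th entry of [J1]. *)
Definition join_inr (V : finType) (J1 J2 : seq V) (z : V) : join_vertex J2 :=
  if insub z is Some w then inr w else inl (nth z J1 (index z J2)).

(** For duplicate-free [J1], [J2] of the same size, [join_inr J1 J2] is
    injective and [sgraph_of] discards nothing. *)
Definition join (V : finType) (H : sgraph V) (J1 J2 : seq V) :
    sgraph (join_vertex J2) :=
  sgraph_of (image_edges inl (edges H)
             :|: image_edges (join_inr J1 J2) (edges H))%SET.

(** The collection [J_t(H)]; a [t]-join has [2 |V(H)| - t] vertices. *)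
Definition joins (h : nat) (H : sgraph 'I_h) (t : nat) :
    {set sgraph 'I_(2 * h - t)} :=
  up_to_iso [set F : sgraph 'I_(2 * h - t) |
    [exists J1 : t.-tuple 'I_h, exists J2 : t.-tuple 'I_h,
      [&& uniq J1, uniq J2 & iso (join H J1 J2) F]]]%SET.

(** * Probability *)

(** Mutual independence of the family [X i], [i \in D]. *)
Definition mutually_independent (R : realType) (d d' : measure_display)
    (T : measurableType d) (T' : measurableType d') (P : probability T R)
    (I : choiceType) (D : set I) (X : I -> {RV P >-> T'}) : Prop :=
  forall (J : {fset I}) (A : I -> set T'),
    [set` J] `<=` D -> (forall i, i \in J -> measurable (A i)) ->
    P (\bigcap_(i in [set` J]) (X i @^-1` A i)) =
      (\prod_(i <- J) P (X i @^-1` A i))%E.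
Arguments mutually_independent {R d d' T T'} P {I} D X.

(** [X] is uniform on [{1, ..., c}]. *)
Definition uniform_color (R : realType) (d : measure_display)
    (T : measurableType d) (P : probability T R) (c : nat)
    (X : {RV P >-> nat}) : Prop :=
  forall i : nat, (1 <= i <= c)%N -> distribution P X [set i] = (c%:R^-1)%:E.
Arguments uniform_color {R d T} P c X.

Definition cvg_in_distribution (R : realType)
    (d : nat -> measure_display) (T : forall n, measurableType (d n))
    (P : forall n, probability (T n) R) (X : forall n, {RV (P n) >-> R})
    (d' : measure_display) (T' : measurableType d') (Q : probability T' R)
    (Y : {RV Q >-> R}) : Prop :=
  forall x : R, {for x, continuous (cdf (P := Q) Y)} ->
    cdf (P := P n) (X n) x @[n --> \oo] --> cdf (P := Q) Y x.
Arguments cvg_in_distribution {R d T} P X {d' T'} Q Y.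

(** [T(H, G)] for the coloring [X] of the vertices of [G]; the product runs
    over the edges [{a, b}] of [H], each taken once, with [a < b]. *)
Definition mono_copies (R : realType) (h : nat) (H : sgraph 'I_h)
    (V : finType) (G : sgraph V) (X : V -> nat) : R :=
  #|Aut H|%:R^-1 *
  \sum_(s : {ffun 'I_h -> V} | injectiveb s)
    (\prod_(a < h) \prod_(b < h | (a < b)%N && adj H a b)
        (adj G (s a) (s b))%:R) *
    [forall a, forall b, X (s a) == X (s b)]%:R.

Section random_variables.
Context (R : realType) (d : measure_display) (T : measurableType d).
Context (P : probability T R).

Definition mono_copies_fun (h : nat) (H : sgraph 'I_h) (V : finType)
    (G : sgraph V) (X : V -> {RV P >-> nat}) : T -> R :=
  fun w => mono_copies R H G (fun v => X v w).

Lemma measurable_forallb (I : finType) (f : I -> T -> bool) :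
  (forall i, measurable_fun setT (f i)) ->
  measurable_fun setT (fun w => [forall i, f i w]).
Proof.
move=> mf.
rewrite (_ : (fun w => _) = fun w => all (f^~ w) (enum I)); last first.
  apply/funext => w; apply/forallP/allP => [h i _ //|h i].
  by apply: h; rewrite mem_enum.
by elim: (enum I) => [|i s ih] //=; exact: measurable_and.
Qed.

Lemma measurable_mono_copies_fun (h : nat) (H : sgraph 'I_h) (V : finType)
    (G : sgraph V) (X : V -> {RV P >-> nat}) :
  measurable_fun setT (mono_copies_fun H G X).
Proof.
rewrite /mono_copies_fun /mono_copies; apply: measurable_funM => //.
under eq_fun do rewrite -big_filter.
apply: measurable_sum => s; apply: measurable_funM => //.
rewrite (_ : (fun w => _) = (fun w =>
  if [forall a, forall b, X (s a) w == X (s b) w] then 1 else 0)); last first.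
  by apply/funext => w; case: ifP.
apply: measurable_fun_ifT => //.
apply: measurable_forallb => a; apply: measurable_forallb => b.
exact: measurable_fun_eqn.
Qed.

HB.instance Definition _ (h : nat) (H : sgraph 'I_h) (V : finType)
    (G : sgraph V) (X : V -> {RV P >-> nat}) :=
  isMeasurableFun.Build _ _ _ _ (mono_copies_fun H G X)
    (measurable_mono_copies_fun H G X).

Definition weighted_sum (N : nat) (Z : nat -> {RV P >-> nat}) : T -> R :=
  fun w => \sum_(1 <= k < N.+1) k%:R * (Z k w)%:R.

Lemma measurable_weighted_sum (N : nat) (Z : nat -> {RV P >-> nat}) :
  measurable_fun setT (weighted_sum N Z).
Proof.
apply: measurable_sum => k; apply: measurable_funM => //.
exact: (measurableT_comp (f := fun n : nat => n%:R : R)).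
Qed.

HB.instance Definition _ (N : nat) (Z : nat -> {RV P >-> nat}) :=
  isMeasurableFun.Build _ _ _ _ (weighted_sum N Z)
    (measurable_weighted_sum N Z).

End random_variables.

(* Main.v *)
Require Import Defs.
From HB Require Import structures.
From mathcomp Require Import all_boot all_order all_algebra finmap perm.
From mathcomp Require Import all_classical all_reals all_analysis.
From mathcomp Require Import zify ring lra.

Set Implicit Arguments.
Unset Strict Implicit.
Unset Printing Implicit Defensive.

Import Order.TTheory GRing.Theory Num.Theory.
Import numFieldNormedType.Exports.

(** A set [S] of [h] vertices carries [a S := #|copies_on H G S|] copies of
    [H], and they are all monochromatic as soon as [S] is. So the count is
    [W = \sum_S a S * 1{S monochromatic}], where each [S] is monochromatic with
    probability [p = c ^ -(h - 1)], and the first hypothesis says that the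
    number of [S] with [a S = k], multiplied by [p], tends to [lambda k]
    ([sum_ninduced]). The proof is a variant of the Stein-Chen method that works
    directly with point masses: it shows that
      [m * P(W = m) = \sum_k k * lambda k * P(W = m - k) + o(1)]
    for every [m], a recursion that the law of [\sum_k k Z_k] satisfies
    exactly ([limit_mass_rec]). The recursion determines all masses up to the
    factor [P(W = 0)]. As the mean of [W] is bounded, no mass escapes to
    infinity, which determines that factor ([recursion_cvg]).

    To obtain the recursion, write
      [m * P(W = m) = \sum_S a S * P(S monochromatic, W = m)].
    Pick [v \in S] and recolour all of [S] with the colour of [v]: the result is
    distributed as the colouring conditioned on [S] being monochromatic
    ([mean_recolor]). So the [S]-term is [a S * p * P(W' = m)], with [W'] the
    weight after recolouring, and it remains to see that [W' = W + a S] up to a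
    small probability. The two sides can differ only if some other [S'] meeting
    [S] outside [v] is monochromatic before or after recolouring, or if [S]
    already was ([mono_weight_recolor]).

    - Sets [S'] with [t >= 2] common vertices contribute in total
      the number of such pairs [(S, S')] times [c ^ -(2 * h - t - 1)], up to a
      constant. Each pair spans a [t]-join of [H] ([joined_copies]), so this
      is [o(1)] by the second hypothesis ([overlap_mass_le]).
    - Sets [S'] meeting [S] in one vertex need more care: the hypotheses allow
      many of them, for instance when all copies share a vertex. This is why
      recolouring keeps the colour of one vertex, and why [v] is chosen of
      maximal degree in [S], the degree being the number of sets with
      [a S > 0] that contain the vertex. What
      remains is [p ^ 2] times the sum of the degrees of the other vertices of
      [S] over all [S]. Since these are at most [sqrt (deg u * deg v)], the
      Cauchy-Schwarz inequality bounds that sum by the codegrees, whose squares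
      count the pairs with at least two common vertices
      ([nonmaximal_degree_sum], [sum_codegree]).

    Distinct sets of [h] vertices have fewer than [h] common vertices, and the
    diagonal pairs are harmless because [p] tends to [0]. *)

(** * Copies and isomorphism classes of graphs *)

Section graphs.
Import mathcomp.boot.fintype mathcomp.boot.finset.
Local Open Scope set_scope.

Lemma imset_pair (U V : finType) (f : U -> V) (a b : U) :
  f @: [set a; b] = [set f a; f b].
Proof. by rewrite imsetU !imset_set1. Qed.

Lemma card_edge (V : finType) (G : sgraph V) (e : {set V}) :
  e \in edges G -> #|e| = 2.
Proof. by move=> eG; apply/eqP; exact: (forall_inP (edgesP G)). Qed.

Lemma image_edges_comp (U V W : finType) (f : U -> V) (g : V -> W) E :
  image_edges (g \o f) E = image_edges g (image_edges f E).
Proof. by rewrite /image_edges -imset_comp; apply: eq_imset => e /=; exact: imset_comp. Qed.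

Lemma eq_image_edges (U V : finType) (f g : U -> V) E :
  f =1 g -> image_edges f E = image_edges g E.
Proof. by move=> fg; apply: eq_imset => e; exact: eq_imset. Qed.

Lemma image_edges_id (U : finType) (E : {set {set U}}) : image_edges id E = E.
Proof.
rewrite /image_edges -[RHS]imset_id; apply: eq_imset => e; exact: imset_id.
Qed.

Lemma image_edges_inj (U V : finType) (f : U -> V) :
  injective f -> injective (image_edges f).
Proof. by move=> fI; apply: imset_inj; exact: imset_inj. Qed.

Lemma image_edgesS (U V : finType) (f : U -> V) (E E' : {set {set U}}) :
  E \subset E' -> image_edges f E \subset image_edges f E'.
Proof. exact: imsetS. Qed.

Lemma is_copyP (U V : finType) (F : sgraph U) (S : {set V}) E :
  reflect (exists f : U -> V, [/\ injective f, S = f @: [set: U]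
             & E = image_edges f (edges F)])
          (is_copy F S E).
Proof.
have imT (f : U -> V) : [set f x | x : U] = f @: [set: U].
  by apply/setP => y; apply/imsetP/imsetP => -[x _ ->]; exists x; rewrite ?inE.
apply: (iffP existsP) => [[f /and3P[/injectiveP fI /eqP -> /eqP ->]]|[f [fI -> ->]]].
  by exists f; rewrite imT.
exists [ffun x => f x]; apply/and3P; split.
- by apply/injectiveP => x y; rewrite !ffunE => /fI.
- by rewrite imT; apply/eqP; apply: eq_imset => x; rewrite ffunE.
- by apply/eqP; apply: eq_image_edges => x; rewrite ffunE.
Qed.

Lemma is_copy_refl (U : finType) (F : sgraph U) : is_copy F [set: U] (edges F).
Proof.
by apply/is_copyP; exists id; split; rewrite ?imset_id ?image_edges_id.
Qed.

Lemma is_copy_image (U V W : finType) (F : sgraph U) (f : V -> W)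
    (S : {set V}) E :
  injective f -> is_copy F S E -> is_copy F (f @: S) (image_edges f E).
Proof.
move=> fI /is_copyP[g [gI -> ->]]; apply/is_copyP; exists (f \o g); split.
- exact: inj_comp.
- by rewrite imset_comp.
- by rewrite image_edges_comp.
Qed.

Lemma is_copy_preimage (U V W : finType) (F : sgraph U) (f : V -> W)
    (S : {set V}) E :
  injective f -> is_copy F (f @: S) (image_edges f E) -> is_copy F S E.
Proof.
move=> fI /is_copyP[g [gI gS gE]].
have /fin_all_exists[k kE] x : exists y, g x = f y.
  have : g x \in f @: S by rewrite gS imset_f.
  by case/imsetP => y _ ->; exists y.
have gk : g =1 f \o k by [].
apply/is_copyP; exists k; split.
- by move=> x y kxy; apply: gI; rewrite !kE kxy.
- by apply: (imset_inj fI); rewrite gS (eq_imset _ gk) imset_comp.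
- by apply: (image_edges_inj fI); rewrite gE (eq_image_edges _ gk) image_edges_comp.
Qed.

Lemma is_copy_card (U V : finType) (F : sgraph U) (S : {set V}) E :
  is_copy F S E -> #|S| = #|U|.
Proof. by case/is_copyP => f [fI -> _]; rewrite card_imset ?cardsT. Qed.

Lemma is_copy_iso (U V W : finType) (F : sgraph U) (G : sgraph V)
    (S : {set W}) E :
  iso F G -> is_copy G S E -> is_copy F S E.
Proof.
move=> FG /is_copyP[g [gI -> ->]]; exact: is_copy_image.
Qed.

(** The embedding that realises the second copy is injective, so the first one
    can be pulled back along it. *)
Lemma iso_of_is_copy (U V W : finType) (F : sgraph U) (G : sgraph V)
    (S : {set W}) E :
  is_copy F S E -> is_copy G S E -> iso F G.
Proof.
move=> FE /is_copyP[g [gI gS gE]].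
by apply: (is_copy_preimage gI); rewrite -gS -gE.
Qed.

Lemma iso_refl (U : finType) (F : sgraph U) : iso F F.
Proof. exact: is_copy_refl. Qed.

Lemma iso_sym (U V : finType) (F : sgraph U) (G : sgraph V) :
  iso F G -> iso G F.
Proof. by move=> FG; apply: iso_of_is_copy FG; exact: is_copy_refl. Qed.

Lemma iso_trans (U V W : finType) (F : sgraph U) (G : sgraph V) (K : sgraph W) :
  iso F G -> iso G K -> iso F K.
Proof. exact: is_copy_iso. Qed.

Lemma iso_equivalence_rel (V : finType) (D : {set sgraph V}) :
  {in D & &, equivalence_rel (@iso V V)}.
Proof.
move=> x y z _ _ _; split; first exact: iso_refl.
by move=> xy; apply/idP/idP; apply: iso_trans => //; exact: iso_sym.
Qed.

Lemma up_to_iso_sub (V : finType) (D : {set sgraph V}) F :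
  F \in up_to_iso D -> F \in D.
Proof.
move=> FD.
have eqv := @iso_equivalence_rel V D.
have tr := transversalP (equivalence_partitionP eqv).
by have /subsetP := transversal_sub tr; apply.
Qed.

Lemma up_to_iso_exists (V : finType) (D : {set sgraph V}) F :
  F \in D -> exists2 F', F' \in up_to_iso D & iso F' F.
Proof.
move=> FD.
have eqv := @iso_equivalence_rel V D.
have part := equivalence_partitionP eqv.
have tr := transversalP part.
have PF : pblock (equivalence_partition (@iso V V) D) F
    \in equivalence_partition (@iso V V) D.
  by apply: pblock_mem; rewrite (cover_partition part).
exists (transversal_repr F (up_to_iso D) (pblock (equivalence_partition (@iso V V) D) F)).
  exact: (repr_mem_transversal tr).
set F' := transversal_repr _ _ _.
have F'P : F' \in pblock (equivalence_partition (@iso V V) D) F.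
  exact: (repr_mem_pblock tr).
have F'D : F' \in D.
  rewrite -(cover_partition part); apply/bigcupP.
  by exists (pblock (equivalence_partition (@iso V V) D) F).
by move: F'P; rewrite (pblock_equivalence_partition eqv) // => /iso_sym.
Qed.

Lemma up_to_iso_uniq (V : finType) (D : {set sgraph V}) F F' :
  F \in up_to_iso D -> F' \in up_to_iso D -> iso F F' -> F = F'.
Proof.
move=> FD F'D FF'.
have eqv := @iso_equivalence_rel V D.
have part := equivalence_partitionP eqv.
have tr := transversalP part.
apply: (pblock_inj tr FD F'D).
apply: same_pblock; first by case/and3P: part.
rewrite (pblock_equivalence_partition eqv) ?(up_to_iso_sub FD) ?(up_to_iso_sub F'D) //.
exact: iso_sym.
Qed.

End graphs.

(** * Copies on a given set of vertices *)

Section copies.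
Import mathcomp.boot.fintype mathcomp.boot.finset.
Local Open Scope set_scope.

Definition copies_on (U V : finType) (H : sgraph U) (G : sgraph V)
    (S : {set V}) : {set {set {set V}}} :=
  [set E | subgraph G (S, E) && is_copy H S E].

Lemma subgraphE (V : finType) (G : sgraph V) S E :
  subgraph G (S, E) = (E \subset induced_edges G S).
Proof.
apply/andP/subsetP => /= [[/subsetP EG /forall_inP ES] e eE|sub].
  by rewrite inE EG ?ES.
split; first by apply/subsetP => e /sub; rewrite inE => /andP[].
by apply/forall_inP => e /sub; rewrite inE => /andP[].
Qed.

(** This is how subgraphs of a copy are pulled back along the embedding. *)
Lemma sub_image_edges (U V : finType) (f : U -> V) (E : {set {set V}}) E0 :
  E \subset image_edges f E0 -> E = image_edges f [set e in E0 | f @: e \in E].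
Proof.
move=> /subsetP sub; apply/setP => e; apply/idP/imsetP => [eE|[e0]].
  by have /imsetP[e0 e0E ee0] := sub _ eE; exists e0; rewrite // inE e0E -ee0.
by rewrite inE => /andP[_ ? ->].
Qed.

(** A copy of [H] inside [F] is spanning, since both have the vertex type [U],
    so it is given by its edges; transport these along the isomorphism between
    [F] and [G] induced on [S]. *)
Lemma ncopies_induced (U V : finType) (H F : sgraph U) (G : sgraph V) S :
  is_copy F S (induced_edges G S) -> ncopies H F = #|copies_on H G S|.
Proof.
case/is_copyP => f [fI SE EF].
have full (A : {set U}) E : is_copy H A E -> A = [set: U].
  move=> /is_copy_card pU; apply/eqP; rewrite eqEcard finset.subsetT cardsT.
  by rewrite pU leqnn.
rewrite /ncopies -(card_in_imset (f := fun p => image_edges f p.2)); last first.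
  move=> [p1 p2] [q1 q2]; rewrite !inE => /andP[_ /full /= ->] /andP[_ /full /= ->].
  by move=> /(image_edges_inj fI) ->.
apply: eq_card => E; rewrite !inE; apply/imsetP/andP.
- case=> p; rewrite inE => /andP[/andP[pF _] pH] ->; split.
    by rewrite subgraphE EF image_edgesS.
  by rewrite SE -(full _ _ pH); exact: is_copy_image.
- rewrite subgraphE EF => -[/sub_image_edges EE]; rewrite EE => EH.
  exists ([set: U], [set e in edges F | f @: e \in E]) => //.
  rewrite inE; apply/andP; split; last first.
    by apply: (is_copy_preimage fI); rewrite -SE.
  apply/andP; split; first by apply/subsetP => e; rewrite inE => /andP[].
  by apply/forall_inP => e _; exact: finset.subsetT.
Qed.

Lemma ncopies_le_complete (m h : nat) (H : sgraph 'I_m) (F : sgraph 'I_h) :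
  (ncopies H F <= ncopies H (complete h))%N.
Proof.
apply: subset_leq_card; apply/subsetP => p; rewrite !inE.
move=> /andP[/andP[/subsetP pF pS] ->]; rewrite andbT; apply/andP; split => //.
by apply/subsetP => e /pF eF; rewrite !inE /= (card_edge eF).
Qed.

Lemma exists_is_copy (U V : finType) (f : U -> V) (E : {set {set V}}) :
  injective f -> (forall e, e \in E -> (#|e| == 2) && (e \subset f @: [set: U])) ->
  exists F : sgraph U, is_copy F (f @: [set: U]) E.
Proof.
move=> fI EP; exists (sgraph_of [set e : {set U} | f @: e \in E]).
apply/is_copyP; exists f; split => //.
apply/setP => e; apply/idP/imsetP => [eE|[e0]]; last first.
  by rewrite !inE => /andP[? _] ->.
have /andP[e2 /subsetP eS] := EP _ eE.
have ee : e = f @: [set x | f x \in e].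
  apply/setP => y; apply/idP/imsetP => [ye|[x]]; last by rewrite inE => ? ->.
  by have /imsetP[x _ yx] := eS _ ye; exists x; rewrite // inE -yx.
exists [set x | f x \in e] => //.
by rewrite !inE -ee eE -(card_imset _ fI) -ee.
Qed.

Lemma exists_induced_copy (U V : finType) (H : sgraph U) (G : sgraph V) S :
  (0 < #|copies_on H G S|)%N ->
  exists F : sgraph U, is_copy F S (induced_edges G S).
Proof.
case/card_gt0P => E; rewrite inE => /andP[_ /is_copyP[f [fI SE _]]].
rewrite SE; apply: exists_is_copy => // e.
by rewrite inE => /andP[/card_edge -> ->].
Qed.

Lemma copies_on_le (h : nat) (H : sgraph 'I_h) (V : finType) (G : sgraph V) S :
  (#|copies_on H G S| <= ncopies H (complete h))%N.
Proof.
have [-> //|S0] := posnP #|copies_on H G S|.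
have [F FS] := exists_induced_copy S0.
by rewrite -(ncopies_induced H FS) ncopies_le_complete.
Qed.

Lemma copies_on_card (U V : finType) (H : sgraph U) (G : sgraph V) S :
  (0 < #|copies_on H G S|)%N -> #|S| = #|U|.
Proof.
by case/card_gt0P => E; rewrite inE => /andP[_ /is_copy_card].
Qed.

(** For [k > 0], a set carrying [k] copies of [H] induces a graph isomorphic to
    exactly one representative in [overgraphs H k]. For [k = 0] the left-hand
    side is empty. *)
Lemma sum_ninduced (h : nat) (H : sgraph 'I_h) (V : finType) (G : sgraph V) k :
  (0 < k)%N ->
  \sum_(F in overgraphs H k) ninduced F G = #|[set S | #|copies_on H G S| == k]|.
Proof.
move=> k0; under eq_bigr do rewrite /ninduced -sum1dep_card big_mkcond.
rewrite exchange_big /= -sum1dep_card [RHS]big_mkcond /=.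
apply: eq_bigr => S _; rewrite -big_mkcondr /=.
case: ifPn => [/eqP Sk|Sk].
- have [F0 F0S] := @exists_induced_copy _ _ H G S ltac:(by rewrite Sk).
  have F0k := ncopies_induced H F0S.
  have [|F FD FF0] := @up_to_iso_exists _ [set F | (0 < ncopies H F)%N && (ncopies H F == k)] F0.
    by rewrite inE F0k Sk eqxx k0.
  have FS := is_copy_iso FF0 F0S.
  rewrite (big_pred1 F) // => F1 /=; apply/andP/eqP => [[F1D F1S]|-> //].
  exact: (up_to_iso_uniq F1D FD (iso_of_is_copy F1S FS)).
- rewrite big_pred0 // => F; apply: contraNF Sk => /andP[FD FS].
  rewrite -(ncopies_induced H FS).
  by move: (up_to_iso_sub FD); rewrite inE => /andP[].
Qed.

Lemma leq_card_bigcup (I T : finType) (P : pred I) (F : I -> {set T}) :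
  (#|\bigcup_(i | P i) F i| <= \sum_(i | P i) #|F i|)%N.
Proof.
elim/big_rec2: _ => [|i n A _ An]; first by rewrite cards0.
by rewrite (leq_trans (leq_card_setU _ _)) // leq_add2l.
Qed.

End copies.

(** * Overlapping copies and joins *)

Section joins.
Import mathcomp.boot.fintype mathcomp.boot.finset.
Local Open Scope set_scope.

Lemma card_image_edges (U V : finType) (H : sgraph U) (f : U -> V) e :
  injective f -> e \in image_edges f (edges H) -> #|e| = 2.
Proof. by move=> fI /imsetP[e0 /card_edge e2 ->]; rewrite card_imset. Qed.

Lemma enum_image (U V : finType) (f : U -> V) (W : {set V}) :
  W \subset f @: [set: U] -> exists J : seq U, map f J = enum W.
Proof.
move=> /subsetP Wf; have {Wf} : {subset enum W <= f @: [set: U]}.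
  by move=> x; rewrite mem_enum => /Wf.
elim: (enum W) => [_|x s ih xs]; first by exists [::].
have [|J <-] := ih; first by move=> y ys; apply: xs; rewrite inE ys orbT.
have /imsetP[y _ ->] : x \in f @: [set: U] by apply: xs; rewrite mem_head.
by exists (y :: J).
Qed.

(** Take [J1] and [J2] to list the vertices that the two embeddings send to the
    common part of their images, in the same order; gluing the embeddings then
    gives an injective map on the join. *)
Lemma is_copy_join (U V : finType) (H : sgraph U) (f f' : U -> V) (S S' : {set V}) :
  injective f -> injective f' -> S = f @: [set: U] -> S' = f' @: [set: U] ->
  exists J1 J2 : #|S :&: S'|.-tuple U, [/\ uniq J1, uniq J2 &
    is_copy (join H J1 J2) (S :|: S')
      (image_edges f (edges H) :|: image_edges f' (edges H))].
Proof.
move=> fI f'I ->{S} ->{S'}; set S := f @: _; set S' := f' @: _.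
have [J1 J1E] : exists J, map f J = enum (S :&: S').
  by apply: enum_image; exact: subsetIl.
have [J2 J2E] : exists J, map f' J = enum (S :&: S').
  by apply: enum_image; exact: subsetIr.
have sz1 : size J1 == #|S :&: S'| by rewrite -(size_map f) J1E cardE.
have sz2 : size J2 == #|S :&: S'| by rewrite -(size_map f') J2E cardE.
exists (Tuple sz1), (Tuple sz2).
split => /=.
- by rewrite -(map_inj_uniq fI) J1E enum_uniq.
- by rewrite -(map_inj_uniq f'I) J2E enum_uniq.
pose g (x : join_vertex J2) := match x with inl z => f z | inr w => f' (val w) end.
(* [map f J1 = map f' J2], so identified vertices have the same image. *)
have gJ z : g (join_inr J1 J2 z) = f' z.
  rewrite /join_inr; case: insubP => [w _ <- //|]; rewrite negbK /= => zJ2.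
  have iz : (index z J2 < size J2)%N by rewrite index_mem.
  rewrite -(nth_map z (f z)) ?(eqP sz1) -?(eqP sz2) // J1E -J2E.
  by rewrite (nth_map z) // nth_index.
have gI : injective g.
  have disj z (w : {z | z \notin J2}) : f z <> f' (val w).
    move=> fw; have /negP := valP w; apply.
    rewrite -(mem_map f'I) J2E mem_enum inE -{1}fw.
    by apply/andP; split; apply: imset_f; rewrite inE.
  move=> [z|w] [z'|w'] //=; first by move/fI ->.
  - by move/disj.
  - by move/esym/disj.
  - by move/f'I/val_inj ->.
have jI : injective (join_inr J1 J2).
  by move=> z z' zz'; apply: f'I; rewrite -!gJ zz'.
apply/is_copyP; exists g; split => //.
- apply/setP => x; rewrite inE; apply/orP/imsetP.
    case=> /imsetP[y _ ->]; first by exists (inl y).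
    by exists (join_inr J1 J2 y); rewrite ?inE ?gJ.
  case=> -[z|w] _ ->; [left|right]; exact: imset_f.
- have -> : edges (join H J1 J2)
      = image_edges inl (edges H) :|: image_edges (join_inr J1 J2) (edges H).
    apply/setP => e; rewrite inE; case: (boolP (e \in _)) => //=.
    by rewrite inE => /orP[] /card_image_edges -> // ? ? [].
  rewrite /image_edges imsetU -!/(image_edges _ _) -!image_edges_comp.
  by congr (_ :|: _); apply: eq_image_edges => z; rewrite /= ?gJ.
Qed.

Lemma joined_copies (h : nat) (H : sgraph 'I_h) (V : finType) (G : sgraph V) S S' :
  (0 < #|copies_on H G S|)%N -> (0 < #|copies_on H G S'|)%N ->
  exists2 F, F \in joins H #|S :&: S'| &
    exists E, subgraph G (S :|: S', E) && is_copy F (S :|: S') E.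
Proof.
move=> aS aS'; have cS := copies_on_card aS; have cS' := copies_on_card aS'.
have cU : #|S :|: S'| = (2 * h - #|S :&: S'|)%N.
  by rewrite cardsU cS cS' card_ord mul2n addnn.
case/card_gt0P: aS => E; rewrite inE subgraphE => /andP[EG /is_copyP[f [fI SE EE]]].
case/card_gt0P: aS' => E'; rewrite inE subgraphE => /andP[EG' /is_copyP[f' [fI' SE' EE']]].
have [J1 [J2]] := is_copy_join H fI fI' SE SE'.
rewrite -EE -EE' => -[uJ1 uJ2 copyJ].
have EEG : E :|: E' \subset induced_edges G (S :|: S').
  apply/subsetP => e; rewrite !inE => /orP[/(subsetP EG)|/(subsetP EG')].
    by rewrite inE => /andP[-> /subset_trans -> //]; exact: subsetUl.
  by rewrite inE => /andP[-> /subset_trans -> //]; exact: subsetUr.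
pose f0 (i : 'I_(2 * h - #|S :&: S'|)) : V := enum_val (cast_ord (esym cU) i).
have f0I : injective f0 by move=> i j /enum_val_inj/cast_ord_inj.
have f0E : f0 @: finset.setT = S :|: S'.
  apply/eqP; rewrite eqEcard card_imset // cardsT card_ord cU leqnn andbT.
  by apply/subsetP => x /imsetP[i _ ->]; exact: enum_valP.
have [F0] : exists F : sgraph 'I_(2 * h - #|S :&: S'|), is_copy F (S :|: S') (E :|: E').
  rewrite -f0E; apply: exists_is_copy => // e /(subsetP EEG).
  by rewrite f0E inE => /andP[/card_edge -> ->].
move=> copyF0.
have [|F FJ FF0] := @up_to_iso_exists _ [set F : sgraph 'I_(2 * h - #|S :&: S'|) |
    [exists J1 : #|S :&: S'|.-tuple 'I_h, exists J2 : #|S :&: S'|.-tuple 'I_h,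
      [&& uniq J1, uniq J2 & iso (join H J1 J2) F]]] F0.
  rewrite inE; apply/existsP; exists J1; apply/existsP; exists J2.
  by rewrite uJ1 uJ2 (iso_of_is_copy copyJ copyF0).
exists F => //; exists (E :|: E').
by rewrite subgraphE EEG (is_copy_iso FF0 copyF0).
Qed.

(** A pair of overlapping copies is sent to the copy of a join that it spans, on
    the vertex set [S :|: S']. At most [2 ^ (2 * h)] sets [S], and as many [S'],
    are contained in that vertex set, so each copy of a join is reached a
    bounded number of times. *)
Lemma card_joined_copies (h : nat) (H : sgraph 'I_h) (V : finType) (G : sgraph V) t :
  (#|[set p : {set V} * {set V} | [&& 0 < #|copies_on H G p.1|,
        0 < #|copies_on H G p.2| & #|p.1 :&: p.2| == t]]|
    <= 2 ^ (4 * h) * \sum_(F in joins H t) ncopies F G)%N.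
Proof.
set A := [set p | _].
pose B (q : {set V} * {set {set V}}) := setX (powerset q.1) (powerset q.1).
pose C (F : sgraph 'I_(2 * h - t)) :=
  [set q : {set V} * {set {set V}} | subgraph G q && is_copy F q.1 q.2].
have sub : A \subset \bigcup_(F in joins H t) \bigcup_(q in C F) B q.
  apply/subsetP => -[S S']; rewrite inE => /and3P[aS aS' /eqP /= St].
  have [] := joined_copies aS aS'; rewrite /= St => F FJ [E EP].
  apply/bigcupP; exists F => //; apply/bigcupP; exists (S :|: S', E).
    by rewrite inE.
  by rewrite !inE /= subsetUl subsetUr.
apply: (leq_trans (subset_leq_card sub)).
apply: (leq_trans (leq_card_bigcup _ _)).
rewrite big_distrr /=; apply: leq_sum => F _.
apply: (leq_trans (leq_card_bigcup _ _)).
rewrite mulnC -sum_nat_const; apply: leq_sum => q.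
rewrite inE => /andP[_ /is_copy_card qF].
rewrite cardsX !card_powerset qF card_ord -expnD leq_pexp2l //.
by rewrite addnn -mul2n (_ : 4 * h = 2 * (2 * h))%N; [rewrite leq_mul2l leq_subr|rewrite mulnA].
Qed.

End joins.

(** * Monochromatic copies *)

Section monochromatic.
Import mathcomp.boot.fintype mathcomp.boot.finset.
Local Open Scope set_scope.

Definition monochromatic (V : finType) (C : eqType) (X : V -> C) (S : {set V}) :=
  [forall u in S, forall v in S, X u == X v].

Lemma AutE (V : finType) (H : sgraph V) (p : {perm V}) :
  (p \in Aut H) = (image_edges p (edges H) == edges H).
Proof.
have pI := @perm_inj _ p.
rewrite inE; apply/forallP/eqP => [pH|pH u]; last first.
  apply/forallP => v; rewrite /adj -imset_pair -{1}pH mem_imset //.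
  exact: imset_inj.
apply/eqP; rewrite eqEcard card_imset ?leqnn ?andbT; last exact: imset_inj.
apply/subsetP => e /imsetP[e0 e0H ->].
have /eqP/cards2P[u [v [uv e0E]]] := card_edge e0H.
by rewrite e0E imset_pair; have /forallP/(_ v)/eqP := pH u; rewrite /adj => ->; rewrite -e0E.
Qed.

(** Two embeddings with the same image differ by a permutation of [U] that
    preserves the edges of [H]. *)
Lemma card_parametrizations (U V : finType) (H : sgraph U) (S : {set V}) E :
  is_copy H S E ->
  #|[set s : {ffun U -> V} | injectiveb s &&
       ((s @: [set: U], image_edges s (edges H)) == (S, E))]| = #|Aut H|.
Proof.
case/is_copyP => f [fI SE EE].
rewrite -(@card_imset _ _ (fun p : {perm U} => [ffun x => f (p x)])); last first.
  by move=> p q /ffunP pq; apply/permP => x; have := pq x; rewrite !ffunE => /fI.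
apply: eq_card => s; rewrite inE; apply/andP/imsetP; last first.
  case=> p; rewrite AutE => /eqP pH ->.
  have sE : [ffun x => f (p x)] =1 f \o p by move=> x; rewrite ffunE.
  split; first by apply/injectiveP => x y; rewrite !sE /= => /fI/perm_inj.
  rewrite (eq_imset _ sE) imset_comp (eq_image_edges _ sE) image_edges_comp pH -EE.
  suff -> : p @: [set: U] = [set: U] by rewrite -SE.
  by apply/setP => x; rewrite inE; apply/imsetP; exists (p^-1%g x); rewrite ?inE ?permKV.
rewrite xpair_eqE => -[/injectiveP sI /andP[/eqP sS /eqP sE]].
have /fin_all_exists[k kE] x : exists y, s x = f y.
  have : s x \in f @: [set: U] by rewrite -SE -sS imset_f.
  by case/imsetP => y _ ->; exists y.
have kI : injective k by move=> x y kxy; apply: sI; rewrite !kE kxy.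
have sfk : s =1 f \o k by [].
exists (perm kI); last by apply/ffunP => x; rewrite ffunE permE.
rewrite AutE; apply/eqP/(image_edges_inj fI).
rewrite -EE -sE (eq_image_edges _ sfk) image_edges_comp; congr image_edges.
by apply: eq_image_edges => x; rewrite permE.
Qed.

(** Group the embeddings by the copy of [H] that they parametrise. *)
Lemma sum_embeddings (U V : finType) (H : sgraph U) (G : sgraph V)
    (Q : pred {set V}) :
  (\sum_(s : {ffun U -> V} | injectiveb s)
     ((image_edges s (edges H) \subset edges G) && Q (s @: [set: U]))
   = #|Aut H| * \sum_S #|copies_on H G S| * Q S)%N.
Proof.
have -> : (\sum_S #|copies_on H G S| * Q S = \sum_(p : {set V} * {set {set V}} |
    subgraph G p && is_copy H p.1 p.2) Q p.1)%N.
  under eq_bigr do rewrite -sum_nat_const.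
  rewrite pair_big_dep /=; apply: eq_bigl => -[S E]; by rewrite inE.
rewrite big_distrr /=.
under eq_bigr do rewrite -mulnb mulnC.
transitivity (\sum_(s : {ffun U -> V} |
    injectiveb s && (image_edges s (edges H) \subset edges G)) Q (s @: [set: U]))%N.
  rewrite [RHS]big_mkcondr; apply: eq_bigr => s _; case: (_ \subset _).
    by rewrite muln1.
  by rewrite muln0.
rewrite (partition_big (fun s : {ffun U -> V} => (s @: [set: U], image_edges s (edges H)))
  (fun p => subgraph G p && is_copy H p.1 p.2)) /=; last first.
  move=> s /andP[/injectiveP sI sG]; apply/andP; split.
    rewrite subgraphE; apply/subsetP => e /[dup] /(subsetP sG) eG.
    rewrite inE eG => /imsetP[e0 _ ->]; apply: imsetS; exact: finset.subsetT.
  by apply/is_copyP; exists s.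
apply: eq_bigr => -[S E] /andP[SG SEc].
rewrite -(card_parametrizations SEc) -sum1dep_card big_distrl /=.
apply: congr_big => //= [s|s]; last first.
  by move=> /andP[_]; rewrite xpair_eqE => /andP[/eqP -> _]; rewrite mul1n.
rewrite -andbA; congr (_ && _); rewrite xpair_eqE.
apply/andP/idP => [[]//|sSE]; split => //.
case/andP: sSE => _ /eqP ->; apply/subsetP => e.
by move: SG; rewrite subgraphE => /subsetP/[apply]; rewrite inE => /andP[].
Qed.

Local Open Scope ring_scope.

Lemma prod_natb (R : comNzRingType) (I : finType) (P : pred I) (b : I -> bool) :
  \prod_(i | P i) (b i)%:R = [forall i, P i ==> b i]%:R :> R.
Proof.
case: (boolP [forall i, _]) => [/forall_inP Pb|].
  by rewrite big1 // => i /Pb ->.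
rewrite negb_forall => /existsP[i]; rewrite negb_imply => /andP[Pi /negbTE bi].
by rewrite (bigD1 i) //= bi mul0r.
Qed.

Lemma mono_copiesE (R : realType) (h : nat) (H : sgraph 'I_h) (V : finType)
    (G : sgraph V) (X : V -> nat) :
  mono_copies R H G X = (\sum_S #|copies_on H G S| * monochromatic X S)%N%:R.
Proof.
have A0 : #|Aut H|%:R != 0 :> R.
  rewrite pnatr_eq0 -lt0n; apply/card_gt0P; exists 1%g; rewrite AutE.
  rewrite (@eq_image_edges _ _ _ id) ?image_edges_id // => x; exact: perm1.
rewrite /mono_copies; apply: (mulfI A0); rewrite mulrA divff // mul1r -natrM.
rewrite -sum_embeddings natr_sum; apply: eq_bigr => s /injectiveP sI.
under eq_bigr do rewrite prod_natb; rewrite prod_natb -natrM mulnb; congr (_ : bool)%:R.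
congr (_ && _).
- apply/forallP/subsetP => [sH e|sG a].
    case/imsetP => e0 e0H ->; have /eqP/cards2P[u [v [uv e0E]]] := card_edge e0H.
    rewrite e0E imset_pair; move: (uv); rewrite neq_ltn => /orP[luv|lvu].
      by have /forallP/(_ v) := sH u; rewrite luv /adj -e0E e0H.
    have /forallP/(_ u) := sH v.
    by rewrite lvu /adj (finset.setUC [set v]) -e0E e0H (finset.setUC [set s u]).
  rewrite implyTb; apply/forallP => b; apply/implyP => /andP[_ abH].
  by apply: sG; rewrite -imset_pair; exact: imset_f.
- apply/forallP/forall_inP => [Xs u /imsetP[a _ ->]|Xs a].
    by apply/forall_inP => v /imsetP[b _ ->]; exact: (forallP (Xs a)).
  by apply/forallP => b; apply: (forall_inP (Xs (s a) _)); rewrite imset_f.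
Qed.

End monochromatic.

(** * Averages over a finite type *)

Section mean.
Variable R : realFieldType.
Local Open Scope ring_scope.

Definition mean (I : finType) (f : I -> R) : R := (\sum_i f i) / #|I|%:R.

Definition prob (I : finType) (A : pred I) : R := mean (fun i => (A i)%:R).

Lemma eq_mean (I : finType) (f g : I -> R) : f =1 g -> mean f = mean g.
Proof. by move=> fg; congr (_ / _); apply: eq_bigr. Qed.

Lemma meanZ (I : finType) a (f : I -> R) : mean (fun i => a * f i) = a * mean f.
Proof. by rewrite /mean -mulr_sumr mulrA. Qed.

Lemma mean_sum (I J : finType) (P : pred J) (f : J -> I -> R) :
  mean (fun i => \sum_(j | P j) f j i) = \sum_(j | P j) mean (f j).
Proof. by rewrite /mean exchange_big mulr_suml. Qed.

Lemma meanD (I : finType) (f g : I -> R) :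
  mean (fun i => f i + g i) = mean f + mean g.
Proof. by rewrite /mean big_split mulrDl. Qed.

Lemma ler_mean (I : finType) (f g : I -> R) :
  (forall i, f i <= g i) -> mean f <= mean g.
Proof.
by move=> fg; rewrite /mean ler_wpM2r ?invr_ge0 ?ler0n // ler_sum.
Qed.

Lemma prob_ge0 (I : finType) (A : pred I) : 0 <= prob A.
Proof. by rewrite divr_ge0 ?ler0n // sumr_ge0 => // i _; rewrite ler0n. Qed.

Lemma prob_le1 (I : finType) (A : pred I) : prob A <= 1.
Proof.
rewrite /prob /mean -natr_sum; have [I0|I0] := posnP #|I|.
  by rewrite I0 invr0 mulr0.
rewrite ler_pdivrMr ?ltr0n // mul1r ler_nat -[leqRHS]sum1_card leq_sum // => i _.
by case: (A i).
Qed.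

Lemma dist_prob (I : finType) (A B : pred I) :
  `|prob A - prob B| <= prob (fun i => A i != B i).
Proof.
rewrite /prob /mean -mulrBl normrM normfV (ger0_norm (ler0n _ _)).
rewrite ler_wpM2r ?invr_ge0 ?ler0n // -sumrB (le_trans (ler_norm_sum _ _ _)) //.
apply: ler_sum => i _; case: (A i) (B i) => [] [] /=;
  by rewrite ?subrr ?subr0 ?sub0r ?normrN ?normr0 ?normr1.
Qed.

End mean.

(** * Recolouring a set of vertices *)

Section recolor.
Import mathcomp.boot.fintype mathcomp.boot.finset.
Variable R : realFieldType.
Variables (V : finType) (c : nat).
Hypothesis c_gt0 : (0 < c)%N.
Implicit Types (S : {set V}) (x y : {ffun V -> 'I_c}).
Local Open Scope ring_scope.

Definition recolor S (v : V) x : {ffun V -> 'I_c} :=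
  [ffun u => if u \in S then x v else x u].

Lemma monochromatic_recolor S v x : monochromatic (recolor S v x) S.
Proof.
by apply/forall_inP => u uS; apply/forall_inP => w wS; rewrite !ffunE uS wS.
Qed.

Lemma card_recolor S v y : v \in S -> monochromatic y S ->
  #|[set x | recolor S v x == y]%SET| = (c ^ #|S|.-1)%N.
Proof.
move=> vS ymono.
(* The fibre is a box: free on [S :\ v], prescribed elsewhere. *)
pose F u := if u \in (S :\ v)%SET then predT else pred1 (y u).
rewrite (_ : [set x | _]%SET = [set x in family F]%SET); last first.
  apply/setP => x; rewrite !inE; apply/eqP/familyP => [yE u|xF].
    rewrite /F -yE !inE ffunE; case: (eqVneq u v) => [->|uv] /=.
      by rewrite vS inE.
    by case: (u \in S) => //=; rewrite inE.
  have xv : x v = y v.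
    by have := xF v; rewrite /F !inE eqxx /= => /eqP.
  apply/ffunP => u; rewrite ffunE; case: ifPn => [uS|uS].
    by rewrite xv; apply/eqP; exact: (forall_inP (forall_inP ymono _ vS)).
  by have := xF u; rewrite /F !inE (negbTE uS) andbF => /eqP.
rewrite cardsE card_family foldrE big_map big_enum /=.
rewrite (cardsD1 v) vS /= -prod_nat_const [RHS]big_mkcond /=.
by apply: eq_bigr => u _; rewrite /F; case: ifP => _; rewrite ?card1 ?card_ord.
Qed.

(** Recolouring maps onto the colourings that are constant on [S], and all its
    fibres have the same size: the other vertices of [S] were free. Hence it
    samples from the law conditioned on [S] being monochromatic. *)
Lemma mean_recolor S v (f : {ffun V -> 'I_c} -> R) : v \in S ->
  mean (fun x => (monochromatic x S)%:R * f x)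
    = mean (fun x => f (recolor S v x)) / (c ^ #|S|.-1)%N%:R.
Proof.
move=> vS; have c0 : (c ^ #|S|.-1)%N%:R != 0 :> R.
  by rewrite pnatr_eq0 -lt0n expn_gt0 c_gt0.
rewrite /mean mulrAC; congr (_ / _); apply: (mulIf c0); rewrite divfK //.
rewrite [RHS](partition_big (recolor S v) (fun y => monochromatic y S)) /=; last first.
  by move=> x _; exact: monochromatic_recolor.
rewrite big_distrl [RHS]big_mkcond /=; apply: eq_bigr => y _.
case: ifPn => ymono; last by rewrite !mul0r.
rewrite mul1r -(card_recolor vS ymono) -sum1dep_card natr_sum mulr_sumr.
by apply: eq_bigr => x /eqP <-; rewrite mulr1.
Qed.

Lemma prob_monochromatic S : S != finset.set0 ->
  prob R (fun x => monochromatic x S) = (c ^ #|S|.-1)%N%:R^-1.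
Proof.
case/set0Pn => v vS; have := mean_recolor (fun=> 1) vS.
rewrite {2}/mean sumr_const divff ?mul1r => [<-|]; last first.
  by rewrite pnatr_eq0 -lt0n card_ffun card_ord expn_gt0 c_gt0.
by apply: eq_mean => x; rewrite mulr1.
Qed.

Lemma monochromaticU S S' x : S :&: S' != finset.set0 ->
  monochromatic x S && monochromatic x S' = monochromatic x (S :|: S').
Proof.
case/set0Pn => w; rewrite inE => /andP[wS wS'].
apply/andP/forall_inP => [[xS xS'] u uU|xU].
  have xw z : z \in S :|: S' -> x z = x w.
    rewrite inE => /orP[] zS; apply/eqP.
      exact: (forall_inP (forall_inP xS z zS)).
    exact: (forall_inP (forall_inP xS' z zS)).
  by apply/forall_inP => z zU; rewrite (xw u uU) (xw z zU).
split; apply/forall_inP => u uS; apply/forall_inP => z zS.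
  by apply: (forall_inP (xU u _)); rewrite inE ?uS ?zS.
by apply: (forall_inP (xU u _)); rewrite inE ?uS ?zS orbT.
Qed.

Lemma monochromatic_recolor_disjoint S S' v x :
  S' :&: S \subset [set v]%SET ->
  monochromatic (recolor S v x) S' = monochromatic x S'.
Proof.
move=> /subsetP sub.
have E u : u \in S' -> recolor S v x u = x u.
  move=> uS'; rewrite ffunE; case: ifPn => // uS.
  by have /set1P -> : u \in [set v]%SET by apply: sub; rewrite inE uS' uS.
apply: eq_forallb => u; case uS': (u \in S') => //=.
apply: eq_forallb => w; case wS': (w \in S') => //=.
by rewrite !E.
Qed.

End recolor.

(** * Overlap estimates in a weighted uniform hypergraph *)

Section hypergraph.
Import mathcomp.boot.fintype mathcomp.boot.finset.
Variable R : realFieldType.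
Variables (V : finType) (c h : nat) (a : {set V} -> nat) (A : nat).
Hypothesis c_gt0 : (0 < c)%N.
Hypothesis h_gt1 : (1 < h)%N.
Hypothesis a_card : forall S, (0 < a S)%N -> #|S| = h.
Hypothesis a_le : forall S, (a S <= A)%N.
Implicit Types (S : {set V}) (x y : {ffun V -> 'I_c}).
Local Open Scope ring_scope.

(** The sets [S] with [a S > 0] are regarded as the edges of an [h]-uniform
    hypergraph, weighted by [a]. *)
Definition mono_weight x : nat := (\sum_S a S * monochromatic x S)%N.

Definition mono_prob : R := (c ^ h.-1)%N%:R^-1.

Local Notation p := mono_prob.

Lemma mono_prob_ge0 : 0 <= p. Proof. by rewrite invr_ge0 ler0n. Qed.

(** Terms [S'] that meet [S] at most in [v] do not see the recolouring. *)
Lemma mono_weight_recolor S v x :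
  mono_weight (recolor S v x) != (mono_weight x + a S)%N ->
  monochromatic x S || [exists S', [&& (0 < a S')%N, S' != S,
    ~~ (S' :&: S \subset [set v]%SET)
    & monochromatic x S' || monochromatic (recolor S v x) S']].
Proof.
apply: contraNT; rewrite negb_or => /andP[xS /existsPn none].
apply/eqP; rewrite /mono_weight (bigD1 S) // [in RHS](bigD1 S) //=.
rewrite monochromatic_recolor (negbTE xS) muln0 muln1 add0n addnC.
congr (_ + _)%N; apply: eq_bigr => S' S'S.
have := none S'; rewrite S'S /=; have [-> //|aS' /=] := posnP (a S').
case: (boolP (_ \subset _)) => [/monochromatic_recolor_disjoint -> //|_] /=.
by rewrite negb_or => /andP[/negbTE -> /negbTE ->].
Qed.

(** The first term is the cost of [S] being monochromatic already. In the sum,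
    the two summands stand for [S'] being monochromatic before and after
    recolouring [S]; the latter probability, times [p], is that of both sets
    being monochromatic. *)
Lemma recolor_error S v (Q : pred nat) : (0 < a S)%N -> v \in S ->
  `|prob R (fun x => monochromatic x S && Q (mono_weight x))
      - p * prob R (fun x => Q (mono_weight x + a S)%N)|
  <= p * prob R (fun x => monochromatic x S)
     + \sum_(S' | [&& (0 < a S')%N, S' != S & ~~ (S' :&: S \subset [set v]%SET)])
         (p * prob R (fun x => monochromatic x S')
          + prob R (fun x => monochromatic x S && monochromatic x S')).
Proof.
move=> aS vS.
have cond (f : pred {ffun V -> 'I_c}) :
    prob R (fun x => monochromatic x S && f x)
      = p * prob R (fun x => f (recolor S v x)).
  rewrite mulrC /p -(a_card aS) -(mean_recolor c_gt0 (fun x => (f x)%:R)) //.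
  by apply: eq_mean => x; rewrite -natrM mulnb.
rewrite cond -mulrBr normrM (ger0_norm mono_prob_ge0).
under eq_bigr do rewrite cond -mulrDr.
rewrite -mulr_sumr -mulrDr ler_wpM2l ?mono_prob_ge0 //.
apply: (le_trans (dist_prob _ _ _)).
under eq_bigr do rewrite /prob -meanD.
rewrite -mean_sum -meanD; apply: ler_mean => x.
case: eqP => [_|/eqP neq] /=.
  by rewrite addr_ge0 ?ler0n // sumr_ge0 // => S' _; rewrite addr_ge0 ?ler0n.
have /mono_weight_recolor/orP[->|/existsP[S']] :
    mono_weight (recolor S v x) != (mono_weight x + a S)%N.
  by apply: contraNneq neq => ->.
- by rewrite lerDl sumr_ge0 // => S' _; rewrite addr_ge0 ?ler0n.
- case/and4P => aS' S'S sub xS'; rewrite ler_wpDl ?ler0n //.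
  rewrite (bigD1 S') /= ?aS' ?S'S // ler_wpDr //.
    by rewrite sumr_ge0 // => S'' _; rewrite addr_ge0 ?ler0n.
  by rewrite -natrD ler_nat; case/orP: xS' => ->; rewrite ?addn1.
Qed.

(** This is the probability that two [h]-sets that meet are both monochromatic,
    as their union has [2 * h - t] vertices. *)
Definition pair_prob S S' : R := (c ^ (2 * h - #|S' :&: S| - 1))%N%:R^-1.

Lemma pair_prob_ge0 S S' : 0 <= pair_prob S S'.
Proof. by rewrite invr_ge0 ler0n. Qed.

Lemma prob_pair S S' : (0 < a S)%N -> (0 < a S')%N -> (0 < #|S' :&: S|)%N ->
  prob R (fun x => monochromatic x S && monochromatic x S') = pair_prob S S'.
Proof.
move=> aS aS'; rewrite card_gt0 setIC => SS'.
have -> : prob R (fun x => monochromatic x S && monochromatic x S')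
    = prob R (fun x : {ffun V -> 'I_c} => monochromatic x (S :|: S')).
  by apply: eq_mean => x; rewrite monochromaticU.
have U0 : S :|: S' != finset.set0.
  apply: contraNneq SS'; rewrite -!finset.subset0 => <-.
  by rewrite (subset_trans (subsetIl _ _)) ?subsetUl.
rewrite prob_monochromatic // cardsU (a_card aS) (a_card aS').
by rewrite /pair_prob setIC addnn mul2n subn1.
Qed.

Lemma mono_prob_pair S S' : (0 < #|S' :&: S|)%N -> p * p <= pair_prob S S'.
Proof.
move=> t0; rewrite /p /pair_prob -invfM -natrM -expnD.
rewrite lef_pV2 ?posrE ?ltr0n ?expn_gt0 ?c_gt0 // ler_nat leq_pexp2l //.
by move: h_gt1 t0; clear; case: h => // k _; lia.
Qed.

Definition degree (u : V) : nat := #|[set S | (0 < a S)%N && (u \in S)]%SET|.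

Definition overlap_mass : R :=
  \sum_(S | (0 < a S)%N) \sum_(S' | [&& (0 < a S')%N, S' != S & (1 < #|S' :&: S|)%N])
    pair_prob S S'.

(** A set [S'] that meets [S] in a single vertex [u] other than [v] is counted by
    the degree of [u]; the events for [S] and [S'] are then independent, whence
    the factor [p * p]. *)
Lemma overlap_sum S v : (0 < a S)%N ->
  \sum_(S' | [&& (0 < a S')%N, S' != S & ~~ (S' :&: S \subset [set v]%SET)])
         (p * prob R (fun x => monochromatic x S')
          + prob R (fun x => monochromatic x S && monochromatic x S'))
  <= 2 * \sum_(S' | [&& (0 < a S')%N, S' != S & (1 < #|S' :&: S|)%N]) pair_prob S S'
     + 2 * (p * p) * \sum_(u in S | u != v) (degree u)%:R.
Proof.
move=> aS.
rewrite [X in _ + _ * X](_ : _ =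
   \sum_(S' | (0 < a S')%N) \sum_(u in S | u != v) (u \in S')%:R); last first.
  rewrite exchange_big /=; apply: eq_bigr => u _.
  by rewrite /degree -sum1dep_card big_mkcondr /= natr_sum; apply: eq_bigr => S' _; case: ifP.
rewrite big_mkcond [\sum_(S' | [&& _, _ & (1 < _)%N]) _]big_mkcond.
rewrite [\sum_(S' | (0 < a S')%N) _]big_mkcond !mulr_sumr -big_split /=.
apply: ler_sum => S' _.
have pp0 : 0 <= 2 * (p * p) by rewrite !mulr_ge0 ?mono_prob_ge0.
have s0 : 0 <= \sum_(u in S | u != v) (u \in S')%:R :> R.
  by rewrite sumr_ge0 // => u _; rewrite ler0n.
have q0 := pair_prob_ge0 S S'.
case: (boolP (0 < a S')%N) => aS' /=; last by rewrite !mulr0 addr0.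
case: (boolP (S' != S)) => S'S /=; last by rewrite mulr0 add0r mulr_ge0.
case: (boolP (_ \subset _)) => sub /=.
  by apply: addr_ge0; [apply: mulr_ge0 => //; case: ifP|exact: mulr_ge0].
have t0 : (0 < #|S' :&: S|)%N.
  by rewrite card_gt0; apply: contraNneq sub => ->; rewrite finset.sub0set.
rewrite prob_pair // prob_monochromatic //; last by rewrite -card_gt0 (a_card aS') ltnW.
rewrite (a_card aS') -/p.
have ppq := mono_prob_pair t0.
case: ifPn => t1.
  by rewrite ler_wpDr ?mulr_ge0 ?mono_prob_ge0 //; lra.
have {}t1 : #|S' :&: S| = 1%N by apply/eqP; rewrite eqn_leq t0 leqNgt t1.
have -> : pair_prob S S' = p * p.
  rewrite /pair_prob /p t1 -invfM -natrM -expnD; congr (_ ^ _)%N%:R^-1.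
  by move: h_gt1; clear; lia.
have -> : p * p + p * p = 2 * (p * p) by ring.
rewrite mulr0 add0r; apply: ler_peMr => //.
have /eqP/cards1P[u uE] := t1.
have /andP[uS' uS] : (u \in S') && (u \in S) by rewrite -in_setI uE inE.
rewrite (bigD1 u) /=; last first.
  by rewrite uS; apply: contraNneq sub => <-; rewrite uE.
by rewrite uS' lerDl sumr_ge0 // => w _; rewrite ler0n.
Qed.

Definition nb_edges : nat := #|[set S | (0 < a S)%N]%SET|.

Lemma sum_degree : (\sum_u degree u = h * nb_edges)%N.
Proof.
rewrite /degree; under eq_bigr do rewrite -sum1dep_card big_mkcondr.
rewrite exchange_big /= /nb_edges mulnC -sum_nat_const.
apply: eq_big => [S|S aS]; first by rewrite inE.
by rewrite -big_mkcond sum1_card a_card.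
Qed.

Definition codegree (u w : V) : nat :=
  #|[set S | [&& (0 < a S)%N, u \in S & w \in S]]%SET|.

Definition nb_overlaps : nat :=
  \sum_(S | (0 < a S)%N) \sum_(S' | (0 < a S')%N) (1 < #|S' :&: S|)%N.

(** The square of a codegree counts the pairs of edges that contain both
    vertices, and two edges have at most [h ^ 2] pairs of common vertices. *)
Lemma sum_codegree :
  (\sum_u \sum_(w | u != w) codegree u w ^ 2 <= h ^ 2 * nb_overlaps)%N.
Proof.
have -> : (\sum_u \sum_(w | u != w) codegree u w ^ 2 =
    \sum_(S | (0 < a S)%N) \sum_(S' | (0 < a S')%N) \sum_u \sum_(w | u != w)
      ((u \in S) && (w \in S)) * ((u \in S') && (w \in S')))%N.
  under [RHS]eq_bigr do rewrite exchange_big.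
  rewrite [RHS]exchange_big /=; apply: eq_bigr => u _.
  under [RHS]eq_bigr do rewrite exchange_big.
  rewrite [RHS]exchange_big /=; apply: eq_bigr => w _.
  rewrite -big_distrlr /= -mulnn.
  by congr (_ * _)%N; rewrite /codegree -sum1dep_card big_mkcondr;
    apply: eq_bigr => S _; case: ifP.
rewrite /nb_overlaps big_distrr /=; apply: leq_sum => S aS.
rewrite big_distrr /=; apply: leq_sum => S' aS'.
have [t1|t1] := leqP #|S' :&: S| 1.
  rewrite muln0 leqn0; apply/eqP/big1 => u _; apply/big1 => w uw.
  rewrite mulnb; apply/eqP; rewrite eqb0; apply: contraL t1.
  move=> /andP[/andP[uS wS] /andP[uS' wS']]; rewrite -ltnNge.
  apply: (@leq_trans #|[set u; w]%SET|); first by rewrite cards2 uw.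
  by apply: subset_leq_card; apply/subsetP => z /set2P[] ->; rewrite inE ?uS ?uS' ?wS ?wS'.
rewrite muln1 -mulnn -{1}(a_card aS) -(a_card aS').
rewrite -sum1_card -sum1_card big_distrlr /= [leqRHS]big_mkcond /=.
apply: leq_sum => u _; case: (u \in S) => /=; last by rewrite big1.
rewrite [leqRHS]big_mkcond [leqLHS]big_mkcond; apply: leq_sum => w _.
case: ifP => // _; rewrite mulnb; case: (w \in S) => //=.
by case: (w \in S'); rewrite ?andbT ?andbF //; case: (u \in S').
Qed.

Lemma nb_overlaps_le :
  nb_overlaps%:R * (p * p) <= nb_edges%:R * (p * p) + overlap_mass.
Proof.
have -> : nb_edges%:R * (p * p) = \sum_(S | (0 < a S)%N) (p * p).
  by rewrite sumr_const /nb_edges cardsE mulr_natl.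
rewrite /nb_overlaps /overlap_mass -big_split /= natr_sum mulr_suml.
apply: ler_sum => S aS; rewrite natr_sum mulr_suml (bigD1 S) //=.
have pp0 : 0 <= p * p by rewrite mulr_ge0 ?mono_prob_ge0.
apply: lerD; first by case: (1 < _)%N; rewrite ?mul1r ?mul0r.
rewrite [leRHS]big_mkcond [leLHS]big_mkcond; apply: ler_sum => S' _.
case: (0 < a S')%N => //=; case: (S' != S) => //=.
case: ifPn => t1; rewrite ?mul1r ?mul0r //.
by apply: mono_prob_pair; apply: ltnW.
Qed.

(** Group the left-hand side by [u] and [w = v S]. A pair [(u, w)] then occurs at
    most [codegree u w] times, and only with [degree u <= degree w]. The
    inequality [2 x y <= x ^ 2 / eta + eta * y ^ 2], followed by
    [degree u ^ 2 <= degree u * degree w], bounds each term. *)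
Lemma nonmaximal_degree_sum (v : {set V} -> V) (eta : R) : 0 < eta ->
  (forall S, (0 < a S)%N -> v S \in S) ->
  (forall S u, (0 < a S)%N -> u \in S -> (degree u <= degree (v S))%N) ->
  2 * \sum_(S | (0 < a S)%N) \sum_(u in S | u != v S) (degree u)%:R
    <= (h ^ 2 * nb_overlaps)%N%:R / eta + eta * ((h * nb_edges) ^ 2)%N%:R.
Proof.
move=> eta0 vS vmax.
pose n u w := #|[set S | [&& (0 < a S)%N, u \in S & v S == w]]%SET|.
have -> : \sum_(S | (0 < a S)%N) \sum_(u in S | u != v S) (degree u)%:R
    = \sum_u \sum_(w | u != w) (n u w)%:R * (degree u)%:R :> R.
  under eq_bigr do rewrite big_mkcond.
  rewrite exchange_big /=; apply: eq_bigr => u _.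
  under [RHS]eq_bigr => w _.
    rewrite /n -sum1dep_card big_mkcondr natr_sum mulr_suml; over.
  rewrite exchange_big /=; apply: eq_bigr => S aS.
  case: (u \in S) => /=; last by rewrite big1 // => w _; rewrite mul0r.
  case: ifPn => uv.
    rewrite (bigD1 (v S)) //= eqxx mul1r big1 ?addr0 // => w /andP[_ wv].
    by rewrite eq_sym (negbTE wv) mul0r.
  rewrite big1 // => w; rewrite (eqP (negbNE uv)) => /negbTE ->.
  by rewrite mul0r.
have le_term u w : 2 * ((n u w)%:R * (degree u)%:R)
    <= (codegree u w ^ 2)%N%:R / eta + eta * ((degree u)%:R * (degree w)%:R) :> R.
  have [n0|n0] := posnP (n u w).
    by rewrite n0 mul0r mulr0 addr_ge0 ?divr_ge0 ?mulr_ge0 ?ler0n ?(ltW eta0).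
  have dd : (degree u <= degree w)%N.
    move: n0 => /card_gt0P[S]; rewrite inE => /and3P[aS uS /eqP <-].
    exact: vmax.
  have nc : (n u w <= codegree u w)%N.
    apply: subset_leq_card; apply/subsetP => S; rewrite !inE.
    by move=> /and3P[aS -> /eqP <-]; rewrite aS vS.
  apply: (@le_trans _ _ ((n u w ^ 2)%N%:R / eta + eta * ((degree u)%:R * (degree u)%:R))).
    rewrite -subr_ge0 natrX.
    have -> : (n u w)%:R ^+ 2 / eta + eta * ((degree u)%:R * (degree u)%:R)
        - 2 * ((n u w)%:R * (degree u)%:R)
      = ((n u w)%:R - eta * (degree u)%:R) ^+ 2 / eta :> R.
      by field; rewrite gt_eqF.
    by rewrite divr_ge0 ?sqr_ge0 ?ltW.
  apply: lerD.
    by rewrite ler_pM2r ?invr_gt0 // ler_nat leq_sqr.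
  by rewrite ler_pM2l // ler_wpM2l ?ler0n // ler_nat.
rewrite mulr_sumr.
apply: (@le_trans _ _ (\sum_u \sum_(w | u != w)
    ((codegree u w ^ 2)%N%:R / eta + eta * ((degree u)%:R * (degree w)%:R)))).
  by apply: ler_sum => u _; rewrite mulr_sumr; apply: ler_sum => w _; exact: le_term.
under eq_bigr do rewrite big_split.
rewrite big_split /=; apply: lerD.
  apply: (@le_trans _ _ ((\sum_u \sum_(w | u != w) codegree u w ^ 2)%N%:R / eta)).
    rewrite natr_sum mulr_suml; apply: ler_sum => u _.
    by rewrite natr_sum mulr_suml.
  by rewrite ler_pM2r ?invr_gt0 // ler_nat sum_codegree.
rewrite -sum_degree -mulnn natrM natr_sum big_distrlr /= mulr_sumr.
apply: ler_sum => u _; rewrite mulr_sumr [leLHS]big_mkcond.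
apply: ler_sum => w _; case: ifP => // _.
by rewrite !mulr_ge0 ?ler0n ?ltW.
Qed.

End hypergraph.

(** * The approximate recursion for the point masses *)

Section defect.
Import mathcomp.boot.fintype mathcomp.boot.finset.
Variable R : realFieldType.
Variables (V : finType) (c h : nat) (a : {set V} -> nat) (A : nat).
Hypothesis c_gt0 : (0 < c)%N.
Hypothesis h_gt1 : (1 < h)%N.
Hypothesis a_card : forall S, (0 < a S)%N -> #|S| = h.
Hypothesis a_le : forall S, (a S <= A)%N.
Implicit Types (S : {set V}) (x y : {ffun V -> 'I_c}).
Local Open Scope ring_scope.

Local Notation p := (mono_prob R c h).
Local Notation W := (@mono_weight V c a).
Local Notation M := (nb_edges a).

Lemma sum_by_value (f : nat -> R) :
  \sum_(S | (0 < a S)%N) f (a S)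
    = \sum_(1 <= k < A.+1) #|[set S | a S == k]%SET|%:R * f k.
Proof.
under [RHS]eq_bigr do rewrite -sum1dep_card big_mkcond natr_sum mulr_suml.
rewrite exchange_big /= big_mkcond; apply: eq_bigr => S _.
case: ifPn => aS.
  rewrite (bigD1_seq (a S)) ?mem_index_iota ?iota_uniq ?aS ?ltnS ?a_le //=.
  rewrite eqxx mul1r big1 ?addr0 // => k kS.
  by rewrite eq_sym (negbTE kS) mul0r.
rewrite big_nat big1 // => k /andP[k0 _]; case: eqP => [ak|_]; last by rewrite mul0r.
by move: aS; rewrite ak k0.
Qed.

Lemma weighted_prob (m : nat) :
  m%:R * prob R (fun x => W x == m)
    = \sum_(S | (0 < a S)%N) (a S)%:R * prob R (fun x => monochromatic x S && (W x == m)).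
Proof.
rewrite /prob -meanZ; under [RHS]eq_bigr do rewrite -meanZ.
rewrite -mean_sum; apply: eq_mean => x; case: eqP => [<-|_]; last first.
  by rewrite mulr0 big1 // => S _; rewrite andbF mulr0.
rewrite mulr1 /mono_weight natr_sum [RHS]big_mkcond; apply: eq_bigr => S _.
by rewrite andbT natrM; case: ifPn => //; rewrite -eqn0Ngt => /eqP ->; rewrite mul0r.
Qed.

(** The parameter [eta] will be small but fixed: then all terms but the last tend
    to [0] with [p * p * nb_edges] and [overlap_mass], and the last one is of
    order [eta] because [p * nb_edges] is bounded. *)
Lemma recursion_defect (m : nat) (eta : R) : 0 < eta ->
  `| m%:R * prob R (fun x => W x == m)
     - \sum_(1 <= k < A.+1) k%:R * (#|[set S | a S == k]%SET|%:R * p)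
         * prob R (fun x => (W x + k)%N == m) |
  <= A%:R * (M%:R * (p * p) + 2 * overlap_mass R c h a
       + (h ^ 2)%N%:R * (M%:R * (p * p) + overlap_mass R c h a) / eta
       + eta * (h ^ 2)%N%:R * (M%:R * p) ^+ 2).
Proof.
move=> eta0.
have p0 : 0 <= p := mono_prob_ge0 R c h.
have pp0 : 0 <= p * p by rewrite mulr_ge0.
have rho0 : 0 <= overlap_mass R c h a.
  by apply: sumr_ge0 => S _; apply: sumr_ge0 => S' _; exact: pair_prob_ge0.
rewrite weighted_prob.
have -> : \sum_(1 <= k < A.+1) k%:R * (#|[set S | a S == k]%SET|%:R * p)
         * prob R (fun x => (W x + k)%N == m)
    = \sum_(S | (0 < a S)%N) (a S)%:R * (p * prob R (fun x => (W x + a S)%N == m)).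
  rewrite (sum_by_value (fun k => k%:R * (p * prob R (fun x => (W x + k)%N == m)))).
  by apply: eq_bigr => k _; ring.
(* Choosing a vertex [v S] for every [S] needs [V] to be inhabited. *)
have [u0 _|V0] := pickP (fun _ : V => true); last first.
  have noS S : (0 < a S)%N = false.
    apply/negP => aS; have := a_card aS; rewrite eq_card0 => [|u]; last by have := V0 u.
    by move: h_gt1; case: h.
  rewrite !big_pred0 //.
  rewrite subrr normr0 mulr_ge0 ?ler0n // !addr_ge0 // ?mulr_ge0 ?ler0n //;
    by rewrite ?invr_ge0 ?addr_ge0 ?mulr_ge0 ?ler0n ?sqr_ge0 // ltW.
have /fin_all_exists[v vP] S : exists u, (0 < a S)%N ->
    (u \in S) /\ (forall w, w \in S -> (degree a w <= degree a u)%N).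
  have [_|aS] := posnP (a S); first by exists u0.
  have /card_gt0P[u1 u1S] : (0 < #|S|)%N by rewrite (a_card aS) ltnW.
  by exists [arg max_(u > u1 in S) degree a u]; case: arg_maxnP.
have vS S : (0 < a S)%N -> v S \in S by move=> /vP[].
have vmax S u : (0 < a S)%N -> u \in S -> (degree a u <= degree a (v S))%N.
  by move=> /vP[_]; apply.
have nm := nonmaximal_degree_sum a_card eta0 vS vmax.
set D := \sum_(S | _) _ in nm.
rewrite -sumrB (le_trans (ler_norm_sum _ _ _)) //.
apply: (@le_trans _ _ (\sum_(S | (0 < a S)%N) A%:R * (p * p +
    (2 * \sum_(S' | [&& (0 < a S')%N, S' != S & (1 < #|S' :&: S|)%N]) pair_prob R c h S S'
     + 2 * (p * p) * \sum_(u in S | u != v S) (degree a u)%:R)))).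
  apply: ler_sum => S aS; rewrite -mulrBr normrM ger0_norm ?ler0n //.
  apply: ler_pM => //; first by rewrite ler_nat.
  have := recolor_error R c_gt0 a_card (pred1 m) aS (vS S aS).
  move=> /le_trans; apply; rewrite prob_monochromatic // -?card_gt0 (a_card aS) ?(ltnW h_gt1) //.
  by rewrite lerD2l; exact: overlap_sum.
have sumpp : \sum_(S | (0 < a S)%N) p * p = M%:R * (p * p).
  by rewrite sumr_const /nb_edges cardsE mulr_natl.
rewrite -mulr_sumr ler_wpM2l ?ler0n // !big_split /= sumpp -!mulr_sumr -/D.
rewrite -/(overlap_mass R c h a).
rewrite addrA -[leRHS]addrA lerD2l.
have ov := nb_overlaps_le R a c_gt0 h_gt1.
rewrite (mulrAC 2) mulrC.
apply: (@le_trans _ _ ((p * p) * ((h ^ 2 * nb_overlaps a)%N%:R / eta + eta * ((h * M) ^ 2)%N%:R))).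
  by rewrite ler_wpM2l.
have -> : eta * (h ^ 2)%N%:R * (M%:R * p) ^+ 2 = p * p * (eta * ((h * M) ^ 2)%N%:R).
  by rewrite !natrX natrM; ring.
rewrite mulrDr lerD2r.
rewrite (mulrA (p * p)) ler_pdivlMr // divfK ?gt_eqF //.
by rewrite natrM mulrCA ler_wpM2l ?ler0n // mulrC.
Qed.

Lemma mono_weight_markov (K : nat) :
  K%:R * prob R (fun x => (K <= W x)%N)
    <= \sum_(1 <= k < A.+1) k%:R * (#|[set S | a S == k]%SET|%:R * p).
Proof.
have -> : \sum_(1 <= k < A.+1) k%:R * (#|[set S | a S == k]%SET|%:R * p)
    = mean (fun x : {ffun V -> 'I_c} => (W x)%:R : R).
  rewrite (eq_mean (g := fun x =>
      \sum_(S | (0 < a S)%N) (a S)%:R * (monochromatic x S)%:R)); last first.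
    move=> x; rewrite /mono_weight natr_sum [RHS]big_mkcond; apply: eq_bigr => S _.
    by rewrite natrM; case: ifPn => //; rewrite -eqn0Ngt => /eqP ->; rewrite mul0r.
  rewrite mean_sum [RHS](eq_bigr (fun S => (a S)%:R * p)); last first.
    move=> S aS; rewrite meanZ; congr (_ * _).
    by rewrite -/(prob _ _) prob_monochromatic // -?card_gt0 (a_card aS) ?(ltnW h_gt1).
  rewrite (sum_by_value (fun k => k%:R * p)).
  by apply: eq_bigr => k _; ring.
rewrite /prob -meanZ; apply: ler_mean => x.
by rewrite -natrM ler_nat; case: (leqP K); rewrite ?muln1 ?muln0.
Qed.

End defect.

Local Open Scope classical_set_scope.
Local Open Scope ring_scope.

(** * Sequences of masses satisfying the recursion in the limit *)

Section sequences.
Context {R : realType}.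

Lemma cvg_bigsum (I : Type) (r : seq I) (P : pred I) (f : I -> nat -> R) (l : I -> R) :
  (forall i, P i -> f i n @[n --> \oo] --> l i) ->
  \sum_(i <- r | P i) f i n @[n --> \oo] --> \sum_(i <- r | P i) l i.
Proof.
move=> fl; elim: r => [|i r ih].
  by under eq_fun do rewrite big_nil; rewrite big_nil; exact: cvg_cst.
under eq_fun do rewrite big_cons; rewrite big_cons.
by case: ifPn => // Pi; apply: cvgD => //; exact: fl.
Qed.

Lemma cvg0_sum (I : Type) (r : seq I) (P : pred I) (f : I -> nat -> R) :
  (forall i, P i -> f i n @[n --> \oo] --> 0) ->
  \sum_(i <- r | P i) f i n @[n --> \oo] --> 0.
Proof.
by move=> fl; have := @cvg_bigsum I r P f (fun=> 0) fl; rewrite big1.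
Qed.

Lemma cvg0_squeeze (f g : nat -> R) :
  (\forall n \near \oo, `|f n| <= g n) -> g n @[n --> \oo] --> 0 ->
  f n @[n --> \oo] --> 0.
Proof.
move=> fg g0; apply/cvgr0Pnorm_le => e e0.
move/cvgr0Pnorm_le/(_ e e0): g0 => g0; near=> n.
apply: (@le_trans _ _ (g n)); first by near: n.
apply: le_trans (ler_norm _) _; by near: n.
Unshelve. all: by end_near.
Qed.

(** Choose [eta] small first, then [n] large. *)
Lemma cvg0_trade (f x y z : nat -> R) (l : R) :
  (forall n eta, 0 < eta -> `|f n| <= x n + y n / eta + eta * z n) ->
  x n @[n --> \oo] --> 0 -> y n @[n --> \oo] --> 0 -> z n @[n --> \oo] --> l ->
  f n @[n --> \oo] --> 0.
Proof.
move=> fP x0 y0 zl; apply/cvgr0Pnorm_le => e e0.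
have l1 : 0 < `|l| + 1 by rewrite ltr_wpDl.
(* Eventually [z n <= `|l| + 1], so [eta * z n] takes a third of [e]. *)
pose eta := e / (3 * (`|l| + 1)).
have eta0 : 0 < eta by rewrite divr_gt0 // mulr_gt0.
have e3 : 0 < e / 3 by rewrite divr_gt0.
have ye3 : 0 < e / 3 * eta by rewrite mulr_gt0.
move/cvgr0Pnorm_le/(_ _ e3): x0 => x0.
move/cvgr0Pnorm_le/(_ _ ye3): y0 => y0.
move/cvgrPdist_le/(_ _ ltr01): zl => zl.
near=> n; apply: (le_trans (fP n eta eta0)).
have -> : e = e / 3 + e / 3 + e / 3 by field.
have zn : `|l - z n| <= 1 by near: n.
apply: lerD; first apply: lerD.
- by apply: le_trans (ler_norm _) _; near: n.
- rewrite ler_pdivrMr //; apply: le_trans (ler_norm _) _; near: n; exact: y0.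
- have -> : e / 3 = eta * (`|l| + 1) by rewrite /eta; field; rewrite gt_eqF.
  rewrite ler_wpM2l ?(ltW eta0) //.
  have := ler_norm l; move: zn; rewrite ler_norml => /andP[? ?] ?; lra.
Unshelve. all: by end_near.
Qed.

Definition shift (f : nat -> R) (k m : nat) : R := if (k <= m)%N then f (m - k)%N else 0.

(** By induction on [m], the recursion gives [q 0 * p n m - q m * p n 0 --> 0].
    Summing over [m] up to a large [K], where both sums of masses are close to
    [1], turns this into [p n 0 --> q 0]; and [q 0] does not vanish, for
    otherwise the recursion would make all of [q] vanish. *)
Lemma recursion_cvg (N : nat) (lam : nat -> R) (p : nat -> nat -> R)
    (q : nat -> R) (C : R) :
  (forall n m, 0 <= p n m) -> (forall n m, p n m <= 1) ->
  (forall K, \forall n \near \oo,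
     1 - C / K.+1%:R <= \sum_(m < K.+1) p n m <= 1) ->
  (forall m, m%:R * p n m - \sum_(1 <= k < N.+1) k%:R * lam k * shift (p n) k m
     @[n --> \oo] --> 0) ->
  (forall m, 0 <= q m) -> (forall m, q m <= 1) ->
  \sum_(m < K.+1) q m @[K --> \oo] --> (1 : R) ->
  (forall m, m%:R * q m = \sum_(1 <= k < N.+1) k%:R * lam k * shift q k m) ->
  forall m, p n m @[n --> \oo] --> q m.
Proof.
move=> p_ge0 p_le1 tight prec q_ge0 q_le1 qsum qrec.
have e0 m : q 0%N * p n m - q m * p n 0%N @[n --> \oo] --> 0.
  elim/ltn_ind: m => -[_|m ih].
    under eq_fun do rewrite subrr; exact: cvg_cst.
  have m0 : m.+1%:R != 0 :> R by rewrite pnatr_eq0.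
  have -> : (fun n => q 0%N * p n m.+1 - q m.+1 * p n 0%N) = (fun n =>
     m.+1%:R^-1 * (q 0%N * (m.+1%:R * p n m.+1
          - \sum_(1 <= k < N.+1) k%:R * lam k * shift (p n) k m.+1)
      + \sum_(1 <= k < N.+1) k%:R * lam k *
          shift (fun j => q 0%N * p n j - q j * p n 0%N) k m.+1)).
    apply/funext => n.
    have -> : \sum_(1 <= k < N.+1) k%:R * lam k *
          shift (fun j => q 0%N * p n j - q j * p n 0%N) k m.+1
       = q 0%N * (\sum_(1 <= k < N.+1) k%:R * lam k * shift (p n) k m.+1)
         - (\sum_(1 <= k < N.+1) k%:R * lam k * shift q k m.+1) * p n 0%N.
      rewrite mulr_sumr mulr_suml -sumrB; apply: eq_bigr => k _.
      by rewrite /shift; case: ifP => _; ring.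
    by rewrite -qrec; field.
  rewrite -[X in _ --> X](mulr0 m.+1%:R^-1); apply: cvgMl_tmp.
  rewrite -[X in _ --> X](addr0 0); apply: cvgD.
    by rewrite -[X in _ --> X](mulr0 (q 0%N)); apply: cvgMl_tmp; exact: prec.
  under eq_fun do rewrite big_nat.
  apply: cvg0_sum => k /andP[k0 _].
  rewrite -[X in _ --> X](mulr0 (k%:R * lam k)); apply: cvgMl_tmp.
  rewrite /shift; case km: (k <= m.+1)%N; last exact: cvg_cst.
  by apply: ih; lia.
have q0_neq0 : q 0%N != 0.
  apply/eqP => q00.
  have qz m : q m = 0.
    elim/ltn_ind: m => -[//|m ih].
    have m0 : m.+1%:R != 0 :> R by rewrite pnatr_eq0.
    apply: (mulfI m0); rewrite mulr0 qrec big_nat big1 // => k /andP[k0 _].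
    rewrite /shift; case: ifP => km; last by rewrite mulr0.
    by rewrite ih ?mulr0 //; lia.
  have : (fun K => \sum_(m < K.+1) q m) n @[n --> \oo] --> (0 : R).
    under eq_fun do rewrite big1 //; exact: cvg_cst.
  move=> h0; have h10 : (1 : R) = 0 := cvg_unique (@Rhausdorff R) qsum h0.
  by have := oner_neq0 R; rewrite h10 eqxx.
have p0 : p n 0%N @[n --> \oo] --> q 0%N.
  apply/cvgrPdist_le => e e_gt0.
  have e3 : 0 < e / 3 by rewrite divr_gt0.
  have [K [K1 K2]] : exists K, `|1 - \sum_(m < K.+1) q m| <= e / 3 /\ C / K.+1%:R <= e / 3.
    move/cvgrPdist_le/(_ _ e3): qsum => qsum.
    have : C / K.+1%:R @[K --> \oo] --> 0.
      rewrite -[X in _ --> X](mulr0 C); apply: cvgMl_tmp; exact: cvg_harmonic.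
    move/cvgr0Pnorm_le/(_ _ e3) => CK.
    near \oo => K; exists K; split; first by near: K.
    by apply: le_trans (ler_norm _) _; near: K.
  have sum0 : \sum_(m < K.+1) (q 0%N * p n m - q m * p n 0%N) @[n --> \oo] --> 0.
    by apply: cvg0_sum => m _; exact: e0.
  move/cvgr0Pnorm_le/(_ _ e3): sum0 => sum0.
  near=> n.
  have /andP[t1 t2] : 1 - C / K.+1%:R <= \sum_(m < K.+1) p n m <= 1 by near: n; exact: tight.
  have : `|\sum_(m < K.+1) (q 0%N * p n m - q m * p n 0%N)| <= e / 3 by near: n.
  rewrite sumrB -mulr_sumr -mulr_suml.
  move: K1 t1 t2; set P := \sum_(m < _) p n m; set Q := \sum_(m < _) q m.
  have := q_ge0 0%N; have := q_le1 0%N; have := p_ge0 n 0%N; have := p_le1 n 0%N.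
  move=> b1 b0 a1 a0; rewrite !ler_norml => /andP[Q1 Q2] t1 t2 /andP[s1 s2].
  have B1 : 0 <= q 0%N * (1 - P) <= e / 3.
    rewrite mulr_ge0 ?subr_ge0 //=; apply: le_trans (ler_piMl _ a1) _.
      by rewrite subr_ge0.
    by apply: le_trans K2; rewrite lerBlDl -lerBlDr.
  have B2 : - (e / 3) <= p n 0%N * (1 - Q) <= e / 3.
    rewrite -ler_norml normrM (ger0_norm b0).
    apply: le_trans (ler_piMl _ b1) _ => //.
    by rewrite ler_norml Q1 Q2.
  move: B1 B2 => /andP[? ?] /andP[? ?]; apply/andP; split; lra.
move=> m; have -> : (fun n => p n m) = (fun n =>
    (q 0%N)^-1 * ((q 0%N * p n m - q m * p n 0%N) + q m * p n 0%N)).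
  by apply/funext => n; field.
rewrite [X in _ --> X](_ : _ = (q 0%N)^-1 * (0 + q m * q 0%N)); last by field.
by apply: cvgMl_tmp; apply: cvgD; [exact: e0|exact: cvgMl_tmp].
Unshelve. all: by end_near.
Qed.

End sequences.

(** * The recursion for compound Poisson masses *)

Section compound.
Variables (R : realType) (N M : nat) (lam : nat -> R) (pmf : nat -> nat -> R).
Hypothesis pmfS : forall k j, (0 < k <= N)%N -> j.+1%:R * pmf k j.+1 = lam k * pmf k j.
Implicit Types z : {ffun 'I_N -> 'I_M.+1}.

Definition weight z : nat := (\sum_(i < N) i.+1 * z i)%N.

Definition vec_prob z : R := \prod_(i < N) pmf i.+1 (z i).

(** Decrement the [i]-th coordinate. For independent Poisson variables this is the
    identity [E (Z_i * f Z_i) = lam i * E (f (Z_i + 1))]. *)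
Lemma weight_shift (i : 'I_N) (m : nat) : (m <= M)%N ->
  \sum_(z | weight z == m) (z i)%:R * vec_prob z
    = lam i.+1 * \sum_(z | (weight z + i.+1 == m)%N) vec_prob z.
Proof.
move=> mM.
pose up z := [ffun k => if k == i then inord (z k).+1 else z k] : {ffun 'I_N -> 'I_M.+1}.
pose down z := [ffun k => if k == i then inord (z k).-1 else z k] : {ffun 'I_N -> 'I_M.+1}.
have wtE z : weight z = (i.+1 * z i + \sum_(k < N | k != i) k.+1 * z k)%N.
  by rewrite /weight (bigD1 i).
have wt_up z : (z i < M)%N -> weight (up z) = (weight z + i.+1)%N.
  move=> zi; rewrite !wtE ffunE eqxx inordK //.
  have -> : (\sum_(k < N | k != i) k.+1 * up z k = \sum_(k < N | k != i) k.+1 * z k)%N.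
    by apply: eq_bigr => k /negbTE ki; rewrite ffunE ki.
  by rewrite mulnS; lia.
have -> : \sum_(z | weight z == m) (z i)%:R * vec_prob z
    = \sum_(z | (weight z == m) && (0 < z i)%N) (z i)%:R * vec_prob z.
  rewrite [RHS]big_mkcondr; apply: eq_bigr => z _.
  by case: ifPn => //; rewrite -eqn0Ngt => /eqP ->; rewrite mul0r.
rewrite (reindex_onto up down) /=; last first.
  move=> z /andP[_ zi]; apply/ffunP => k; rewrite !ffunE; case: eqP => [->|//].
  have zd : nat_of_ord (inord (z i).-1 : 'I_M.+1) = (z i).-1.
    by rewrite inordK // (leq_ltn_trans (leq_pred _)).
  by apply: val_inj; rewrite /= zd prednK // inordK.
rewrite mulr_sumr; apply: eq_big => z; last first.
  case/andP => /andP[_ uzi] _.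
  have zi : (z i < M)%N.
    (* If [z i = M], then [inord M.+1] falls back to [0]. *)
    rewrite ltn_neqAle -ltnS ltn_ord andbT; apply: contraTneq uzi => ziM.
    by rewrite ffunE eqxx ziM /inord /insubd insubF // ltnn.
  rewrite /vec_prob (bigD1 i) // [in RHS](bigD1 i) //= ffunE eqxx inordK //.
  rewrite mulrA pmfS ?ltn_ord // -mulrA; congr (_ * (_ * _)).
  by apply: eq_bigr => k /negbTE ki; rewrite ffunE ki.
apply/andP/eqP => [[/andP[/eqP <- uzi] _]|wz].
  rewrite wt_up // ltn_neqAle -ltnS ltn_ord andbT; apply: contraTneq uzi => ziM.
  by rewrite ffunE eqxx ziM /inord /insubd insubF // ltnn.
have zi : (z i < M)%N.
  have : (i.+1 * z i <= weight z)%N by rewrite wtE leq_addr.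
  by rewrite mulSn; lia.
split; first by rewrite wt_up // wz eqxx ffunE eqxx inordK.
apply/eqP/ffunP => k; rewrite !ffunE; case: eqP => [->|//].
by apply: val_inj; rewrite /= !inordK //= ?inordK // ltnS ltnW.
Qed.

(** Only coordinates up to [M] are allowed, to have a finite sum; for [m <= M]
    no other vector has weight [m]. *)
Definition compound_mass (m : nat) : R := \sum_(z | weight z == m) vec_prob z.

(** Split [m = weight z] into its coordinates in each term of the mass. *)
Lemma compound_rec (m : nat) : (m <= M)%N ->
  m%:R * compound_mass m
    = \sum_(1 <= k < N.+1) k%:R * lam k * shift compound_mass k m.
Proof.
move=> mM; rewrite big_add1 big_mkord /=.
transitivity (\sum_(z | weight z == m) \sum_(i < N) i.+1%:R * ((z i)%:R * vec_prob z)).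
  rewrite mulr_sumr; apply: eq_bigr => z /eqP <-.
  rewrite /weight natr_sum mulr_suml; apply: eq_bigr => i _.
  by rewrite natrM mulrA.
rewrite exchange_big /=; apply: eq_bigr => i _.
rewrite -mulr_sumr weight_shift // mulrA; congr (_ * _).
rewrite /shift; case: ltnP => im.
  rewrite /compound_mass; apply: eq_bigl => z.
  by rewrite -[RHS](eqn_add2r i.+1) subnK.
by rewrite big_pred0 // => z; apply/negbTE; apply/eqP; lia.
Qed.

End compound.

(** * Independent families of integer-valued variables *)

Section families.
Context (R : realType) (d : measure_display) (T : measurableType d).
Context (P : probability T R).

(** Independence is phrased with finite sets of indices, so a finite family is
    reindexed along an injection [e]. *)
Lemma independent_point (K : choiceType) (D : set K) (X : K -> {RV P >-> nat})
    (I : finType) (e : I -> K) (z : I -> nat) :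
  injective e -> (forall i, D (e i)) -> mutually_independent P D X ->
  P [set w | forall i, X (e i) w = z i]
    = (\prod_i P (X (e i) @^-1` [set z i]))%E.
Proof.
move=> eI De indep.
pose J := [fset k in map e (enum I)]%fset.
pose A (k : K) : set nat := [set n | exists i, e i = k /\ z i = n].
have AE i : A (e i) = [set z i].
  by apply/seteqP; split => [n [j [/eI -> <-]] //|n ->]; exists i.
have memJ k : (k \in J) = (k \in map e (enum I)) by rewrite !inE.
have -> : [set w | forall i, X (e i) w = z i] = \bigcap_(k in [set` J]) (X k @^-1` A k).
  apply/seteqP; split => w /= Xw.
    by move=> k; rewrite /= memJ => /mapP[i _ ->]; rewrite AE /= Xw.
  move=> i; have eiJ : e i \in J by rewrite memJ map_f // mem_enum.
  by have := Xw _ eiJ; rewrite /= AE.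
rewrite indep //; last first.
  by move=> k; rewrite /= memJ => /mapP[i _ ->].
have : perm_eq (enum_fset J) (map e (enum I)).
  by apply: uniq_perm; rewrite ?fset_uniq ?(map_inj_uniq eI) ?enum_uniq //; exact: memJ.
move/(perm_big _) => -> /=.
by rewrite big_map big_enum; apply: eq_bigr => i _; rewrite AE.
Qed.

Lemma measurable_point (I : finType) (X : I -> {RV P >-> nat}) (z : I -> nat) :
  measurable [set w | forall i, X i w = z i].
Proof.
have -> : [set w | forall i, X i w = z i]
    = \bigcap_(i in [set: I]) (X i @^-1` [set z i]).
  by apply/seteqP; split => w h i; [move=> _; exact: h|exact: (h i)].
apply: fin_bigcap_measurable => // i _; exact: measurable_funPTI.
Qed.

Lemma measure_partition (J : finType) (Q : pred J) (E : J -> set T) :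
  (forall j, measurable (E j)) -> (forall i j w, E i w -> E j w -> i = j) ->
  P [set w | exists2 j, Q j & E j w] = (\sum_(j | Q j) P (E j))%E.
Proof.
move=> mE dE.
have -> : [set w | exists2 j, Q j & E j w] = \bigcup_(j in [set` enum Q]) E j.
  apply/seteqP; split => w [j /= jQ jE]; exists j => //.
    by rewrite /= mem_enum.
  by move: jQ; rewrite mem_enum.
rewrite measure_fin_bigcup //; last first.
  by move=> i j _ _ [w [Ei Ej]]; exact: dE Ei Ej.
by rewrite -fsbig_seq ?enum_uniq // big_enum.
Qed.

End families.

(** The colourings with values in [1, ..., c] have total probability [1], so
    conditioning on them changes nothing. *)
Lemma uniform_law (R : realType) (d : measure_display) (T : measurableType d)
    (P : probability T R) (V : finType) (c : nat) (X : V -> {RV P >-> nat})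
    (psi : pred (V -> nat)) :
  (0 < c)%N -> (forall v, uniform_color P c (X v)) ->
  mutually_independent P [set: V] X ->
  measurable [set w | psi (fun v => X v w)] ->
  P [set w | psi (fun v => X v w)]
    = (prob R (fun x : {ffun V -> 'I_c} => psi (fun v => (x v).+1)))%:E.
Proof.
move=> c0 unif indep mB; set B := [set w | _] in mB *.
pose E (x : {ffun V -> 'I_c}) := [set w | forall v, X v w = (x v).+1].
have mE x : measurable (E x) by exact: measurable_point.
have dE x y w : E x w -> E y w -> x = y.
  by move=> xw yw; apply/ffunP => v; apply: val_inj; apply: succn_inj; rewrite -xw yw.
have PE x : P (E x) = ((c ^ #|V|)%N%:R^-1)%:E.
  rewrite (independent_point _ (@inj_id V) _ indep) //.
  under eq_bigr => v _.
    rewrite -[P _]/(distribution P (X v) [set (x v).+1]) unif ?ltn_ord //; over.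
  by rewrite prodEFin prodr_const natrX exprVn.
have card0 : (c ^ #|V|)%N%:R != 0 :> R by rewrite pnatr_eq0 -lt0n expn_gt0 c0.
have sumE (Q : pred {ffun V -> 'I_c}) :
    P [set w | exists2 x, Q x & E x w] = (prob R Q)%:E.
  rewrite measure_partition //; under eq_bigr do rewrite PE.
  rewrite sumEFin /prob /mean card_ffun card_ord mulr_suml big_mkcond /=.
  by congr (_%:E); apply: eq_bigr => x _; case: (Q x); rewrite ?mul1r ?mul0r.
pose A := [set w | exists2 x, xpredT x & E x w].
have mQ (Q : pred {ffun V -> 'I_c}) : measurable [set w | exists2 x, Q x & E x w].
  have -> : [set w | exists2 x, Q x & E x w] = \bigcup_(x in [set` enum Q]) E x.
    apply/seteqP; split => w [x /= xQ xE]; exists x => //.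
      by rewrite /= mem_enum.
    by move: xQ; rewrite mem_enum.
  by apply: fin_bigcup_measurable => //; exact: finite_seq.
have PA : P A = 1%E.
  rewrite sumE /prob /mean sumr_const divff // card_ffun card_ord //.
have PAc : P (~` A) = 0%E by rewrite probability_setC ?PA ?subee //; exact: mQ.
have PBA : P (B `\` A) = 0%E.
  apply: (@subset_measure0 _ _ _ P _ (~` A)).
  - by apply: measurableD => //; exact: mQ.
  - by apply: measurableC; exact: mQ.
  - by move=> w [].
  - exact: PAc.
have := measureDI P mB (mQ xpredT); rewrite -/A [X in (X + _)%E]PBA.
rewrite add0e => ->; rewrite -sumE; congr (P _); apply/seteqP; split => w /=.
  case=> Bw [x _ xw]; exists x => //; move: Bw; rewrite /B /=; congr (is_true (psi _)).
  by apply/funext => v; rewrite xw.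
case=> x xpsi xw; split; last by exists x.
rewrite /B /=; move: xpsi; congr (is_true (psi _)).
by apply/funext => v; rewrite xw.
Qed.

Lemma poisson_pmf_rec (R : realType) (l : R) (j : nat) : 0 <= l ->
  j.+1%:R * fine (poisson_prob l 0 [set j.+1]) = l * fine (poisson_prob l 0 [set j]).
Proof.
move=> l0; rewrite /poisson_prob; case: ifPn => [lpos|]; last first.
  rewrite -leNgt => ln; have -> : l = 0 by apply/eqP; rewrite eq_le l0 ln.
  by rewrite mul0r !diracE /= memNset //= mulr0.
rewrite !esum_set1 ?lee_fin ?poisson_pmf_ge0 //= /poisson_pmf lpos.
rewrite factS natrM exprS; field.
by rewrite -[1]/(1%:R) -natrD add1n !pnatr_eq0 -lt0n fact_gt0.
Qed.

(** * The law of the limit *)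

Section limit_law.
Context (R : realType) (d : measure_display) (T : measurableType d).
Context (Q : probability T R) (N : nat) (lam : nat -> R).
Variable Z : nat -> {RV Q >-> nat}.
Hypothesis lam_ge0 : forall k, (1 <= k <= N)%N -> 0 <= lam k.
Hypothesis Z_pois : forall k, (1 <= k <= N)%N ->
  forall A : set nat, distribution Q (Z k) A = poisson_prob (lam k) 0 A.
Hypothesis Z_indep : mutually_independent Q [set k | (1 <= k <= N)%N] Z.

Definition limit_count (w : T) : nat := (\sum_(1 <= k < N.+1) k * Z k w)%N.

Definition limit_mass (m : nat) : R := fine (Q [set w | limit_count w = m]).

Let pmf (k j : nat) : R := fine (poisson_prob (lam k) 0 [set j]).

Lemma limit_massE (M m : nat) : (m <= M)%N -> limit_mass m = compound_mass N M pmf m.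
Proof.
move=> mM; rewrite /limit_mass /compound_mass.
pose E (z : {ffun 'I_N -> 'I_M.+1}) := [set w | forall i : 'I_N, Z i.+1 w = z i].
have mE z : measurable (E z) by exact: (measurable_point (fun i : 'I_N => Z i.+1)).
have PE z : Q (E z) = (vec_prob pmf z)%:E.
  rewrite /E (independent_point (e := fun i : 'I_N => i.+1) _ _ _ Z_indep) //=.
    rewrite /vec_prob -prodEFin; apply: eq_bigr => i _.
    rewrite -[Q _]/(distribution Q (Z i.+1) [set (z i : nat)]).
    rewrite /pmf -Z_pois ?ltn_ord // fineK //.
    by rewrite fin_num_measure.
  by move=> i j [] /val_inj.
have cE w : limit_count w = (\sum_(i < N) i.+1 * Z i.+1 w)%N.
  by rewrite /limit_count big_add1 big_mkord.
have -> : [set w | limit_count w = m] = [set w | exists2 z, weight z == m & E z w].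
  apply/seteqP; split => w /=; last first.
    case=> z /eqP <- zw; rewrite cE; apply: eq_bigr => i _; by rewrite zw.
  move=> wm.
  have Zlt (i : 'I_N) : (Z i.+1 w < M.+1)%N.
    rewrite ltnS (leq_trans _ mM) // -wm cE (bigD1 i) //=.
    by rewrite mulSn -addnA leq_addr.
  exists [ffun i => Ordinal (Zlt i)].
    by rewrite /weight -wm cE; apply/eqP/eq_bigr => i _; rewrite ffunE.
  by move=> i; rewrite ffunE.
rewrite measure_partition //; last first.
  move=> x y w xw yw; apply/ffunP => i; apply: val_inj.
  by rewrite -[LHS]/(x i : nat) -xw yw.
by under eq_bigr do rewrite PE; rewrite sumEFin.
Qed.

Lemma limit_mass_rec (m : nat) :
  m%:R * limit_mass m = \sum_(1 <= k < N.+1) k%:R * lam k * shift limit_mass k m.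
Proof.
rewrite (limit_massE (leqnn m)) (@compound_rec _ _ _ lam) //; last first.
  by move=> k j kN; apply: poisson_pmf_rec; exact: lam_ge0.
apply: eq_bigr => k _; congr (_ * _); rewrite /shift; case: ifP => // km.
by rewrite (@limit_massE m) // leq_subr.
Qed.

Lemma limit_mass_ge0 m : 0 <= limit_mass m.
Proof. by rewrite fine_ge0. Qed.

Lemma weighted_sumE w : weighted_sum N Z w = (limit_count w)%:R.
Proof.
by rewrite /weighted_sum /limit_count natr_sum; apply: eq_bigr => k _; rewrite natrM.
Qed.

End limit_law.

(** * Convergence in distribution of integer-valued variables *)

Section integer_valued.
Context (R : realType) (d : measure_display) (T : measurableType d).
Context (P : probability T R) (X : {RV P >-> R}) (W : T -> nat).
Hypothesis XW : forall w, X w = (W w)%:R.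

Lemma measurable_mass m : measurable [set w | W w = m].
Proof.
have -> : [set w | W w = m] = X @^-1` [set m%:R].
  apply/seteqP; split => w /=; rewrite XW; first by move=> ->.
  by move/eqP; rewrite eqr_nat => /eqP.
exact: measurable_funPTI.
Qed.

Lemma cdf_integer_valued x K : (forall m : nat, (m%:R <= x) = (m < K)%N) ->
  cdf (P := P) X x = (\sum_(m < K) fine (P [set w | W w = m]))%:E.
Proof.
move=> xK; rewrite /cdf /distribution /pushforward.
have -> : X @^-1` `]-oo, x] = [set w | exists2 m : 'I_K, true & W w = m].
  apply/seteqP; split => w /=; rewrite in_itv /= XW xK.
    by move=> wK; exists (Ordinal wK).
  by case=> m _ ->.
rewrite (measure_partition P xpredT (E := fun m : 'I_K => [set w | W w = m])).
- rewrite -sumEFin; apply: eq_bigr => m _; rewrite fineK // fin_num_measure //.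
  exact: measurable_mass.
- by move=> m; exact: measurable_mass.
- by move=> i j w /= -> /val_inj.
Qed.

Lemma sum_mass_cvg1 :
  \sum_(m < K.+1) fine (P [set w | W w = m]) @[K --> \oo] --> (1 : R).
Proof.
have -> : (fun K => \sum_(m < K.+1) fine (P [set w | W w = m]))
    = (fun K => fine (cdf (P := P) X K%:R)).
  apply/funext => K; rewrite (@cdf_integer_valued _ K.+1) //.
  by move=> m; rewrite ler_nat ltnS.
apply: fine_cvg.
have := @cvg_cdfy1 _ _ _ P X; move/cvge_pinftyP; apply.
exact/cvgryPge/nbhs_infty_ger.
Qed.

End integer_valued.

Lemma nat_threshold (R : realType) (x : R) :
  exists K, forall m : nat, (m%:R <= x) = (m < K)%N.
Proof.
have [x0|x0] := leP 0 x; last first.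
  by exists 0%N => m; rewrite ltn0; apply/negbTE; rewrite -ltNge (lt_le_trans x0).
exists (Num.truncn x).+1 => m; by rewrite ltnS truncn_ge_nat.
Qed.

(** The distribution function of an integer-valued variable is a finite sum of
    masses at every point, so convergence holds at all points and not only at
    continuity points. *)
Lemma cvg_in_distribution_integer (R : realType)
    (d : nat -> measure_display) (T : forall n, measurableType (d n))
    (P : forall n, probability (T n) R) (X : forall n, {RV (P n) >-> R})
    (d' : measure_display) (T' : measurableType d') (Q : probability T' R)
    (Y : {RV Q >-> R}) (W : forall n, T n -> nat) (W' : T' -> nat) :
  (forall n w, X n w = (W n w)%:R) -> (forall w, Y w = (W' w)%:R) ->
  (forall m, fine (P n [set w | W n w = m]) @[n --> \oo]
     --> fine (Q [set w | W' w = m])) ->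
  cvg_in_distribution P X Q Y.
Proof.
move=> XW YW mass x _; have [K xK] := nat_threshold x.
rewrite (cdf_integer_valued YW xK).
under eq_fun do rewrite (cdf_integer_valued (XW _) xK).
apply: cvg_EFin; first exact: nearW.
by apply: cvg_bigsum => m _; exact: mass.
Qed.

(** * From the finite estimates to the limit *)

Lemma prob_lt_eq (R : realFieldType) (I : finType) (W : I -> nat) (K : nat) : (0 < #|I|)%N ->
  \sum_(m < K) prob R (fun x => W x == m) = 1 - prob R (fun x => (K <= W x)%N).
Proof.
move=> I0; apply/eqP; rewrite eq_sym subr_eq eq_sym; apply/eqP.
rewrite /prob -mean_sum -meanD.
rewrite (eq_mean (g := fun=> 1)); last first.
  move=> x; have [WK|WK] := leqP K (W x).
    rewrite big1 ?add0r // => m _; case: eqP => // Wm.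
    by have := ltn_ord m; rewrite -Wm ltnNge WK.
  rewrite addr0 (bigD1 (Ordinal WK)) //= eqxx big1 ?addr0 // => m mW.
  case: eqP => // Wm; case/eqP: mW; exact: val_inj.
by rewrite /mean sumr_const divff // pnatr_eq0 -lt0n.
Qed.

Lemma prob_shift (R : realType) (I : finType) (W : I -> nat) (k m : nat) :
  prob R (fun x => (W x + k)%N == m) = shift (fun j => prob R (fun x => W x == j)) k m.
Proof.
rewrite /shift; case: ifP => km.
  apply: eq_mean => x; congr (_ : bool)%:R.
  by rewrite -[RHS](eqn_add2r k) subnK.
rewrite /prob (eq_mean (g := fun=> 0)) => [|x].
  by rewrite /mean big1 ?mul0r.
by case: eqP => // Wm; move: km; rewrite -Wm leq_addl.
Qed.

Section overlaps.
Import mathcomp.boot.fintype mathcomp.boot.finset.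

(** Distinct sets that both carry copies of [H] have [h] vertices each, hence
    fewer than [h] in common. *)
Lemma overlap_mass_le (R : realFieldType) (h : nat) (H : sgraph 'I_h) (V : finType)
    (G : sgraph V) (c : nat) :
  overlap_mass R c h (fun S => #|copies_on H G S|)
    <= \sum_(2 <= t < h) (2 ^ (4 * h))%N%:R *
         \sum_(F in joins H t) (ncopies F G)%:R / (c ^ (2 * h - t - 1))%N%:R.
Proof.
set a := fun S => #|copies_on H G S|.
pose B t := [set q : {set V} * {set V} |
  [&& (0 < a q.1)%N, (0 < a q.2)%N & #|q.1 :&: q.2| == t]]%SET.
apply: (@le_trans _ _ (\sum_(2 <= t < h) #|B t|%:R / (c ^ (2 * h - t - 1))%N%:R)); last first.
  apply: ler_sum_nat => t _; rewrite -mulr_suml mulrA ler_wpM2r ?invr_ge0 ?ler0n //.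
  by rewrite -natr_sum -natrM ler_nat; exact: card_joined_copies.
rewrite /overlap_mass pair_big_dep /=.
under [leRHS]eq_bigr => t _.
  rewrite -sum1dep_card natr_sum mulr_suml big_mkcond; over.
rewrite exchange_big /= big_mkcond; apply: ler_sum => -[S S'] _ /=.
have term_ge0 t : 0 <= (if [&& (0 < a S)%N, (0 < a S')%N & #|S :&: S'| == t]
    then 1 / (c ^ (2 * h - t - 1))%N%:R else 0 : R).
  by case: ifP => // _; rewrite divr_ge0 ?ler0n.
case: ifP => [/and4P[aS aS' S'S t1]|_]; last by apply: sumr_ge0.
have cS := copies_on_card aS; have cS' := copies_on_card aS'.
have th : (#|S' :&: S| < h)%N.
  rewrite -[X in (_ < X)%N](card_ord h) -cS' ltn_neqAle subset_leq_card ?subsetIl // andbT.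
  apply: contraNneq S'S => eqc; apply/eqP.
  have sub : S' \subset S.
    by apply/setIidPl/eqP; rewrite eqEcard subsetIl eqc leqnn.
  by apply/eqP; rewrite eqEcard sub cS cS' leqnn.
rewrite (bigD1_seq #|S' :&: S|) ?mem_index_iota ?iota_uniq ?t1 //=.
rewrite aS aS' setIC eqxx /= /pair_prob mul1r lerDl; apply: sumr_ge0 => t _.
by case: ifP => // _; rewrite divr_ge0 ?ler0n.
Qed.

End overlaps.

Lemma mono_prob_cvg0 (R : realType) (c : nat -> nat) (h : nat) :
  (1 < h)%N -> (forall n, (0 < c n)%N) -> c n @[n --> \oo] --> \oo ->
  mono_prob R (c n) h @[n --> \oo] --> 0.
Proof.
move=> h1 c0 c_infty; apply/cvgr0Pnorm_le => e e0.
have := nat_threshold e^-1; case=> K KP.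
have cK : \forall n \near \oo, (K < c n)%N.
  exact: (c_infty [set k | (K < k)%N] (nbhs_infty_gt K)).
near=> n.
have cn : (K < c n)%N by near: n.
have e1 : e^-1 <= (c n)%:R.
  by rewrite ltW // ltNge KP -leqNgt ltnW.
rewrite ger0_norm ?mono_prob_ge0 // /mono_prob -[leRHS]invrK.
rewrite lef_pV2 ?posrE ?invr_gt0 ?ltr0n ?expn_gt0 ?c0 //.
apply: le_trans e1 _; rewrite ler_nat -{1}[c n]expn1 leq_pexp2l ?c0 //.
by rewrite -ltnS prednK // ltnW.
Unshelve. all: by end_near.
Qed.

(** * The limit theorem for weighted hypergraphs *)

Section hypergraph_limit.
Variables (R : realType) (V : nat -> finType) (c : nat -> nat) (h A : nat).
Variable a : forall n, {set V n} -> nat.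
Arguments a : clear implicits.
Variables (lam q : nat -> R).
Hypothesis h_gt1 : (1 < h)%N.
Hypothesis c_gt0 : forall n, (0 < c n)%N.
Hypothesis c_infty : c n @[n --> \oo] --> \oo.
Hypothesis a_card : forall n S, (0 < a n S)%N -> #|S| = h.
Hypothesis a_le : forall n S, (a n S <= A)%N.

Let p n : R := mono_prob R (c n) h.
Let lam_ n k : R := #|[set S | a n S == k]%SET|%:R * p n.
Let mass n m : R := prob R (fun x => @mono_weight (V n) (c n) (a n) x == m).

Hypothesis lam_cvg : forall k, (1 <= k <= A)%N -> lam_ n k @[n --> \oo] --> lam k.
Hypothesis overlap0 : overlap_mass R (c n) h (a n) @[n --> \oo] --> 0.

Lemma sum_lam_cvg (g : nat -> R) :
  \sum_(1 <= k < A.+1) g k * lam_ n k @[n --> \oo] --> \sum_(1 <= k < A.+1) g k * lam k.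
Proof.
rewrite big_nat; under eq_fun do rewrite big_nat.
by apply: cvg_bigsum => k kA; apply: cvgMl_tmp; exact: lam_cvg.
Qed.

(** Every edge has a weight between [1] and [A]. *)
Lemma nb_edges_cvg :
  (nb_edges (a n))%:R * p n @[n --> \oo] --> \sum_(1 <= k < A.+1) 1 * lam k.
Proof.
have -> : (fun n => (nb_edges (a n))%:R * p n)
    = (fun n => \sum_(1 <= k < A.+1) 1 * lam_ n k).
  apply/funext => n; have := sum_by_value (@a_le n) (fun=> p n).
  rewrite sumr_const => nbE.
  by rewrite /nb_edges cardsE mulr_natl nbE; apply: eq_bigr => k _; rewrite mul1r.
exact: sum_lam_cvg.
Qed.

(** Replace [lam_ n] by its limit in the recursion, and bound the defect. *)
Lemma mass_recursion m :
  m%:R * mass n m - \sum_(1 <= k < A.+1) k%:R * lam k * shift (mass n) k m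
    @[n --> \oo] --> 0.
Proof.
have -> : (fun n => m%:R * mass n m - \sum_(1 <= k < A.+1) k%:R * lam k * shift (mass n) k m)
  = (fun n => (m%:R * mass n m - \sum_(1 <= k < A.+1) k%:R * lam_ n k * shift (mass n) k m)
     + \sum_(1 <= k < A.+1) k%:R * ((lam_ n k - lam k) * shift (mass n) k m)).
  apply/funext => n; rewrite -addrA; congr (_ + _).
  by rewrite -!sumrN -big_split /=; apply: eq_bigr => k _; ring.
rewrite -[X in _ --> X](addr0 0); apply: cvgD; last first.
  under eq_fun do rewrite big_nat.
  apply: cvg0_sum => k kA; rewrite -[X in _ --> X](mulr0 k%:R); apply: cvgMl_tmp.
  apply: (@cvg0_squeeze _ _ (fun n => `|lam_ n k - lam k|)).
    apply: nearW => n; rewrite normrM ler_piMr //.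
    rewrite /shift; case: ifP => _; last by rewrite normr0.
    by rewrite ger0_norm ?prob_ge0 ?prob_le1.
  apply/cvgr0Pnorm_le => e e0; have /cvgrPdist_le/(_ e e0) := lam_cvg kA.
  by apply: filterS => n; rewrite normr_id distrC.
pose M n : R := (nb_edges (a n))%:R.
pose rho n := overlap_mass R (c n) h (a n).
pose L := \sum_(1 <= k < A.+1) 1 * lam k.
have Mpp : M n * (p n * p n) @[n --> \oo] --> 0.
  have -> : (fun n => M n * (p n * p n)) = (fun n => M n * p n * p n).
    by apply/funext => n; rewrite mulrA.
  rewrite -[X in _ --> X](mulr0 L).
  by apply: cvgM; [exact: nb_edges_cvg|exact: mono_prob_cvg0].
apply: (@cvg0_trade _ _ (fun n => A%:R * (M n * (p n * p n) + 2 * rho n))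
  (fun n => A%:R * ((h ^ 2)%N%:R * (M n * (p n * p n) + rho n)))
  (fun n => A%:R * ((h ^ 2)%N%:R * ((M n * p n) * (M n * p n))))
  (A%:R * ((h ^ 2)%N%:R * (L * L)))).
- move=> n eta eta0.
  have := recursion_defect (c_gt0 n) h_gt1 (@a_card n) (@a_le n) m eta0.
  under eq_bigr do rewrite prob_shift.
  move/le_trans; apply; rewrite -/(p n) -/(M n) -/(rho n) expr2.
  by rewrite le_eqVlt; apply/orP; left; apply/eqP; field; rewrite gt_eqF.
- rewrite -[X in _ --> X](mulr0 A%:R); apply: cvgMl_tmp.
  rewrite -[X in _ --> X](addr0 0); apply: cvgD => //.
  by rewrite -[X in _ --> X](mulr0 2); apply: cvgMl_tmp.
- rewrite -[X in _ --> X](mulr0 A%:R); apply: cvgMl_tmp.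
  rewrite -[X in _ --> X](mulr0 (h ^ 2)%N%:R); apply: cvgMl_tmp.
  by rewrite -[X in _ --> X](addr0 0); apply: cvgD.
- by do 2 apply: cvgMl_tmp; apply: cvgM; exact: nb_edges_cvg.
Qed.

Hypothesis q_ge0 : forall m, 0 <= q m.
Hypothesis q_le1 : forall m, q m <= 1.
Hypothesis q_sum : \sum_(m < K.+1) q m @[K --> \oo] --> (1 : R).
Hypothesis q_rec : forall m,
  m%:R * q m = \sum_(1 <= k < A.+1) k%:R * lam k * shift q k m.

(** Tightness comes from the Markov inequality: the means tend to
    [\sum_k k * lam k]. *)
Lemma mass_cvg m : mass n m @[n --> \oo] --> q m.
Proof.
pose L := \sum_(1 <= k < A.+1) k%:R * lam k.
apply: (@recursion_cvg R A lam mass q (L + 1)) => //.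
- by move=> n j; exact: prob_ge0.
- by move=> n j; exact: prob_le1.
- move=> K; have Lcvg : \sum_(1 <= k < A.+1) k%:R * lam_ n k @[n --> \oo] --> L.
    exact: sum_lam_cvg.
  move/cvgrPdist_le/(_ 1 ltr01): Lcvg => L1; near=> n.
  have Ln : `|L - \sum_(1 <= k < A.+1) k%:R * lam_ n k| <= 1 by near: n.
  have col0 : (0 < #|{ffun V n -> 'I_(c n)}|)%N.
    by rewrite card_ffun card_ord expn_gt0 c_gt0.
  rewrite /mass prob_lt_eq //; apply/andP; split; last by rewrite lerBlDr ler_wpDr ?prob_ge0.
  rewrite lerD2l lerN2 ler_pdivlMr // mulrC.
  apply: le_trans (mono_weight_markov R (c_gt0 n) h_gt1 (@a_card n) (@a_le n) K.+1) _.
  by move: Ln; rewrite ler_norml => /andP[? ?]; rewrite -lerBlDl -lerN2 opprB.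
- exact: mass_recursion.
Unshelve. all: by end_near.
Qed.

End hypergraph_limit.

(** * Monochromatic copies in random colorings *)

Theorem theorem2p1 (R : realType)
  (h : nat) (H : sgraph 'I_h)
  (h_ge2 : (2 <= h)%N) (H_conn : connected_graph H)
  (H_neqK2 : ~~ iso H (complete 2))
  (V : nat -> finType) (G : forall n, sgraph (V n))
  (V_infty : #|V n| @[n --> \oo] --> \oo)
  (c : nat -> nat) (c_gt0 : forall n, (0 < c n)%N)
  (c_infty : c n @[n --> \oo] --> \oo)
  (d : nat -> measure_display) (T : forall n, measurableType (d n))
  (P : forall n, probability (T n) R)
  (X : forall n, V n -> {RV (P n) >-> nat})
  (X_unif : forall n v, uniform_color (P n) (c n) (X n v))
  (X_indep : forall n, mutually_independent (P n) [set: V n] (X n))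
  (lambda : nat -> R)
  (lambda_ge0 : forall k, (1 <= k <= ncopies H (complete h))%N ->
    0 <= lambda k)
  (induced_cvg : forall k, (1 <= k <= ncopies H (complete h))%N ->
    (\sum_(F in overgraphs H k) ninduced F (G n))%:R / (c n)%:R ^+ (h - 1)
      @[n --> \oo] --> lambda k)
  (joins_small : forall t, (2 <= t <= h - 1)%N ->
    forall F, F \in joins H t ->
    (fun n => (ncopies F (G n))%:R : R) =o_\oo
      (fun n => (c n)%:R ^+ (2 * h - t - 1) : R))
  (d' : measure_display) (T' : measurableType d') (Q : probability T' R)
  (Z : nat -> {RV Q >-> nat})
  (Z_pois : forall k, (1 <= k <= ncopies H (complete h))%N ->
    forall A : set nat, distribution Q (Z k) A = poisson_prob (lambda k) 0 A)
  (Z_indep : mutually_independent Q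
    [set k | (1 <= k <= ncopies H (complete h))%N] Z) :
  cvg_in_distribution P
    (fun n => mono_copies_fun H (G n) (X n))
    Q (weighted_sum (ncopies H (complete h)) Z).
Proof.
set N := ncopies H (complete h) in lambda_ge0 induced_cvg Z_pois Z_indep *.
pose a n (S : {set V n}) := #|copies_on H (G n) S|.
pose W n w := (\sum_S a n S * monochromatic (fun v => X n v w) S)%N.
have XW n w : mono_copies_fun H (G n) (X n) w = (W n w)%:R.
  by rewrite /mono_copies_fun mono_copiesE.
pose Y : {RV Q >-> R} := weighted_sum N Z.
have YW w : Y w = (limit_count N Z w)%:R by exact: weighted_sumE.
apply: (@cvg_in_distribution_integer _ _ _ _ _ _ _ _ Y W (limit_count N Z)) => // m.
have massE n : fine (P n [set w | W n w = m])
    = prob R (fun x => @mono_weight (V n) (c n) (a n) x == m).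
  have mW := measurable_mass (XW n) m.
  have -> : [set w | W n w = m] = [set w |
      (\sum_S a n S * monochromatic (fun v => X n v w) S)%N == m].
    by apply/seteqP; split => w /= /eqP.
  rewrite (uniform_law (c := c n) (psi := fun f => (\sum_S a n S * monochromatic f S)%N == m)) //=.
  have -> : [set w | (\sum_S a n S * monochromatic (fun v => X n v w) S)%N == m]
     = [set w | W n w = m].
    by apply/seteqP; split => w /= /eqP.
  exact: mW.
under eq_fun do rewrite massE.
have p_eq n : mono_prob R (c n) h = ((c n)%:R ^+ (h - 1))^-1.
  by rewrite /mono_prob natrX subn1.
apply: (@mass_cvg R V c h N a lambda (limit_mass N Z)) => //.
- by move=> n S aS; rewrite (copies_on_card aS) card_ord.
- by move=> n S; exact: copies_on_le.
- move=> k kN; under eq_fun => n.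
    rewrite p_eq -sum_ninduced; last by case/andP: kN.
    over.
  exact: induced_cvg.
- apply: (@cvg0_squeeze _ _ (fun n => \sum_(2 <= t < h) (2 ^ (4 * h))%N%:R *
         \sum_(F in joins H t) (ncopies F (G n))%:R / (c n ^ (2 * h - t - 1))%N%:R)).
    apply: nearW => n; rewrite ger0_norm ?overlap_mass_le //.
    by apply: sumr_ge0 => S _; apply: sumr_ge0 => S' _; exact: pair_prob_ge0.
  under eq_fun do rewrite big_nat.
  apply: cvg0_sum => t th; rewrite -[X in _ --> X](mulr0 (2 ^ (4 * h))%N%:R); apply: cvgMl_tmp.
  apply: cvg0_sum => F FJ; apply/cvgr0Pnorm_le => e e0.
  have th1 : (2 <= t <= h - 1)%N by move: th h_ge2; clear; lia.
  have /eqoP/(_ e e0) := joins_small t th1 F FJ.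
  apply: filterS => n; rewrite natrX.
  have cn0 : 0 < (c n)%:R ^+ (2 * h - t - 1) :> R by rewrite exprn_gt0 // ltr0n.
  rewrite !ger0_norm ?divr_ge0 ?ler0n ?(ltW cn0) //.
  by rewrite ler_pdivrMr.
- by move=> j; exact: limit_mass_ge0.
- move=> j; have mY := measurable_mass YW j.
  by rewrite /limit_mass -lee_fin fineK ?fin_num_measure ?probability_le1.
- exact: sum_mass_cvg1 YW.
- by move=> j; exact: limit_mass_rec.
Qed.
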